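(* Let $n,s,k$ be integers with $k\geq 2$, $s\geq 2$ and $n\geq sk+1$. Then the automorphism group of the $s$-stable Kneser graph $KG(n,k)_{s\text{-stab}}$ is isomorphic to the dihedral group $D_{2n}$ of order $2n$.
   Context: Let $[n]=\{1,\dots,n\}$. A subset $S\subseteq[n]$ is $s$-stable if for all distinct $i,j\in S$ we have $s\leq |i-j|\leq n-s$. $[n]^k_s$ denotes the family of $s$-stable $k$-element subsets of $[n]$. The $s$-stable Kneser graph $KG(n,k)_{s\text{-stab}}$ has vertex set $[n]^k_s$, two vertices being adjacent iff the corresponding $k$-subsets are disjoint. *)

(* Defs.v *)
From HB Require Import structures.
From mathcomp Require Import all_boot all_order all_fingroup all_algebra.
From mathcomp Require Import all_solvable.

Set Implicit Arguments.
Unset Strict Implicit.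
Unset Printing Implicit Defensive.

(* The ground set {1, ..., n} is represented by 'I_n = {0, ..., n - 1}; the
   shift by one does not change |i - j|. The truncation in [n - s] is harmless:
   if n < s the lower bound s <= |i - j| already fails for all i, j : 'I_n. *)
Definition s_stable (n s : nat) (S : {set 'I_n}) : bool :=
  [forall i in S, forall j in S, (i != j) ==> (s <= `|i - j|%N <= n - s)].

Definition stable_ksets (n k s : nat) : {set {set 'I_n}} :=
  [set S : {set 'I_n} | (#|S| == k) && s_stable s S].

Definition stable_kneser_vertex (n k s : nat) : Type :=
  {S : {set 'I_n} | S \in stable_ksets n k s}.

HB.instance Definition _ (n k s : nat) :=
  [isSub of stable_kneser_vertex n k s for @sval _ _].
HB.instance Definition _ (n k s : nat) :=
  [Finite of stable_kneser_vertex n k s by <:].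

Definition stable_kneser (n k s : nat) : rel (stable_kneser_vertex n k s) :=
  fun u v => [disjoint val u & val v].

Lemma s_stableP (n s : nat) (S : {set 'I_n}) :
  reflect (forall i j : 'I_n, i \in S -> j \in S -> i <> j ->
             s <= `|i - j|%N <= n - s)
          (s_stable s S).
Proof.
apply: (iffP forall_inP) => [H i j iS jS /eqP ij | H i iS].
  by move/forall_inP: (H i iS) => /(_ j jS); rewrite ij.
by apply/forall_inP => j jS; apply/implyP => /eqP; apply: H.
Qed.

Lemma stable_kneser_sym (n k s : nat) : symmetric (@stable_kneser n k s).
Proof. by move=> u v; rewrite /stable_kneser disjoint_sym. Qed.

Lemma stable_kneser_irr (n k s : nat) :
  0 < k -> irreflexive (@stable_kneser n k s).
Proof.
move=> k_gt0 u; rewrite /stable_kneser -setI_eq0 setIid -cards_eq0.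
by have := valP u; rewrite inE => /andP[/eqP-> _]; case: k k_gt0 u.
Qed.

Section GraphAut.
Local Open Scope group_scope.

Definition graph_Aut (V : finType) (e : rel V) : {set {perm V}} :=
  [set f : {perm V} | [forall u, forall v, e (f u) (f v) == e u v]].

Lemma graph_AutP (V : finType) (e : rel V) (f : {perm V}) :
  reflect (forall u v, e (f u) (f v) = e u v) (f \in graph_Aut e).
Proof.
rewrite inE; apply: (iffP forallP) => [H u v | H u].
  by have /forallP/(_ v)/eqP := H u.
by apply/forallP => v; rewrite H.
Qed.

Lemma graph_Aut_group_set (V : finType) (e : rel V) :
  group_set (graph_Aut e).
Proof.
apply/group_setP; split; first by apply/graph_AutP => u v; rewrite !perm1.
move=> f g /graph_AutP Hf /graph_AutP Hg; apply/graph_AutP => u v.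
by rewrite !permM Hg Hf.
Qed.

Canonical graph_Aut_group (V : finType) (e : rel V) : {group {perm V}} :=
  Group (graph_Aut_group_set e).

End GraphAut.

(* Main.v *)
Require Import Defs.
From mathcomp Require Import all_boot all_order all_fingroup all_algebra.
From mathcomp Require Import all_solvable zify.

(** Two intersecting vertices S, T are related by moving one point by less than
    s ("slide") exactly when no third vertex has all the common neighbours of S
    and T among its neighbours: if S and T differ in another way, exchanging a
    point at their first difference yields a third stable set inside their
    union.  Hence every graph automorphism preserves slides.  Betweenness of
    three positions of a sliding point can be read off from the slides, so
    automorphisms also preserve "steps", the moves of one point by one.

    An automorphism fixing a vertex and all its step neighbours fixes the step
    neighbours of those neighbours, hence everything, since steps connect all
    vertices.  The n packed sets {c, c + s, ..., c + (k - 1)s} are the vertices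
    with only two step neighbours, so an automorphism is determined by the image
    of one packed set and of one of its two neighbours: there are at most 2n of
    them, and the rotations and reflections of the circle provide that many. *)

Set Implicit Arguments.
Unset Strict Implicit.
Unset Printing Implicit Defensive.

(** * Forward distance on the circle *)

Section CyclicDistance.
Variable n : nat.
Implicit Types x y z : 'I_n.

(** Oriented on purpose: for distinct points the two orders add up to [n], so both bounds of
    s-stability reduce to [s <= cdist x y] for all ordered pairs. *)
Definition cdist x y : nat := if x <= y then y - x else n + y - x.

(** Written with additions and with the bounds included, so that [lia] gets a complete description
    free of truncated subtraction. *)
Lemma cdistE x y : x < n /\ y < n /\
  ((x <= y /\ x + cdist x y = y) \/ (y < x /\ x + cdist x y = n + y)).
Proof.
rewrite /cdist !ltn_ord; split=> //; split=> //.
have xn := ltn_ord x; case: (leqP x y) => xy; [left|right]; lia.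
Qed.

Lemma ord_neq_val x y : x != y -> x < y \/ y < x.
Proof. by rewrite -val_eqE neq_ltn => /orP. Qed.

Lemma ord_neqI x y : nat_of_ord x <> nat_of_ord y -> x != y.
Proof. by move=> xy; apply/eqP => E; rewrite E in xy. Qed.

Lemma ord_gt0 x : 0 < n.
Proof. exact: leq_ltn_trans (leq0n x) (ltn_ord x). Qed.

Definition shift (t : nat) x : 'I_n := Ordinal (ltn_pmod (x + t) (ord_gt0 x)).

Lemma shiftE t x : x < n /\ (t < n ->
  (x + t < n /\ shift t x = x + t :> nat) \/
  (n <= x + t /\ (shift t x + n = x + t)%N)).
Proof.
split=> // tn /=; have xn := ltn_ord x; case: (ltnP (x + t) n) => h.
  by left; rewrite modn_small.
right; split=> //; rewrite -[in LHS](subnK h) modnDr modn_small ?subnK //; lia.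
Qed.

(** The reflection [a - x] modulo [n]; adding [n - x] avoids truncation. *)
Definition mirror (a : nat) x : 'I_n :=
  Ordinal (ltn_pmod (a + (n - x)) (ord_gt0 x)).

Lemma mirrorE a x : x < n /\ (a < n ->
  (x <= a /\ x + mirror a x = a) \/ (a < x /\ x + mirror a x = a + n)).
Proof.
split=> // an /=; have xn := ltn_ord x; case: (leqP x a) => h; [left|right].
  by split=> //; rewrite (_ : a + (n - x) = a - x + n) ?modnDr ?modn_small; lia.
by split=> //; rewrite modn_small; lia.
Qed.

End CyclicDistance.

(** Rotation invariance: the shape of [cdistE], with the circle cut at [c] instead of 0. *)
Lemma cdist_base n (c x y : 'I_n) : cdist c x < n /\ cdist c y < n /\
  ((cdist c x <= cdist c y /\ cdist c x + cdist x y = cdist c y) \/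
   (cdist c y < cdist c x /\ cdist c x + cdist x y = n + cdist c y)).
Proof.
by have := cdistE c x; have := cdistE c y; have := cdistE x y; lia.
Qed.

Lemma cdist_self n (c : 'I_n) : cdist c c = 0.
Proof. by have := cdistE c c; lia. Qed.

Lemma cdist_base_neq n (c x y : 'I_n) :
  x != y -> cdist c x < cdist c y \/ cdist c y < cdist c x.
Proof.
by move=> /ord_neq_val; have := cdistE c x; have := cdistE c y; lia.
Qed.

Lemma cdist_base_neqI n (c x y : 'I_n) : cdist c x <> cdist c y -> x != y.
Proof. by move=> h; apply/eqP => E; rewrite E in h. Qed.

Definition vertex (n s k : nat) (S : {set 'I_n}) : bool :=
  S \in stable_ksets n k s.

(* [lia] becomes very slow on the discarded hypotheses. *)
Ltac arith :=
  repeat match goal with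
  | H : context [@in_mem] |- _ => clear H
  | H : context [vertex] |- _ => clear H
  | H : context [disjoint] |- _ => clear H
  | H : context [@prop_in1] |- _ => clear H
  | H : context [@prop_in2] |- _ => clear H
  | H : forall _, _ |- _ => clear H
  | H : is_true (_ * _ + 1 <= _) |- _ => clear H
  end; lia.

(* Eliminates [cdist] and [shift] in favour of the integer representatives. *)
Ltac cyclic :=
  intros;
  repeat match goal with
  | H : is_true (?x != _) |- _ =>
      let _ := constr:(nat_of_ord x) in apply ord_neq_val in H
  | H : ?x <> _ |- _ => let _ := constr:(nat_of_ord x) in
      apply (introN eqP) in H; apply ord_neq_val in H
  | H : context [@in_mem] |- _ => clear H
  | H : context [vertex] |- _ => clear H
  | H : context [disjoint] |- _ => clear H
  | H : context [@prop_in1] |- _ => clear H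
  | H : context [@prop_in2] |- _ => clear H
  | H : forall _, _ |- _ => clear H
  | H : is_true (_ * _ + 1 <= _) |- _ => clear H
  | H : ?x = _ |- _ => let _ := constr:(nat_of_ord x) in
      apply (congr1 (@nat_of_ord _)) in H
  | |- is_true (_ != _) => apply: ord_neqI
  | |- is_true (_ == _) => apply/eqP
  | |- _ = _ => apply: ord_inj
  end;
  repeat match goal with
  | |- context [cdist ?x ?y] =>
      let H := fresh in have H := cdistE x y;
      let e := fresh in set (e := cdist x y) in *; clearbody e
  | H0 : context [cdist ?x ?y] |- _ =>
      let H := fresh in have H := cdistE x y;
      let e := fresh in set (e := cdist x y) in *; clearbody e
  end;
  repeat match goal with
  | |- context [shift ?t ?x] =>
      let H := fresh in have H := shiftE t x;
      let e := fresh in set (e := nat_of_ord (shift t x)) in *; clearbody e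
  | H0 : context [shift ?t ?x] |- _ =>
      let H := fresh in have H := shiftE t x;
      let e := fresh in set (e := nat_of_ord (shift t x)) in *; clearbody e
  end;
  repeat match goal with
  | |- context [mirror ?t ?x] =>
      let H := fresh in have H := mirrorE t x;
      let e := fresh in set (e := nat_of_ord (mirror t x)) in *; clearbody e
  | H0 : context [mirror ?t ?x] |- _ =>
      let H := fresh in have H := mirrorE t x;
      let e := fresh in set (e := nat_of_ord (mirror t x)) in *; clearbody e
  end;
  simpl in *; arith.

(* Like [cyclic], but in the coordinate [cdist c], which leaves fewer cases. *)
Ltac cyclic_at c :=
  intros;
  repeat match goal with
  | H : is_true (?x != _) |- _ =>
      let _ := constr:(nat_of_ord x) in apply (cdist_base_neq c) in H
  | H : context [@in_mem] |- _ => clear H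
  | H : context [vertex] |- _ => clear H
  | H : context [disjoint] |- _ => clear H
  | H : context [@prop_in1] |- _ => clear H
  | H : context [@prop_in2] |- _ => clear H
  | H : forall _, _ |- _ => clear H
  | H : is_true (_ * _ + 1 <= _) |- _ => clear H
  | |- is_true (_ != _) => apply: (cdist_base_neqI (c := c))
  end;
  have ? := cdist_self c;
  let rec loop :=
    match goal with
    | |- context [cdist ?x ?y] =>
        match x with c => fail 1 | _ => idtac end;
        let H := fresh in have H := cdist_base c x y;
        let e := fresh in set (e := cdist x y) in *; clearbody e; loop
    | H0 : context [cdist ?x ?y] |- _ =>
        match x with c => fail 1 | _ => idtac end;
        let H := fresh in have H := cdist_base c x y;
        let e := fresh in set (e := cdist x y) in *; clearbody e; loop
    | _ => idtac
    end in loop;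
  simpl in *; arith.

(** * Sliding one point *)

Section StableSets.
Variables n s k : nat.
Hypotheses (hk : 2 <= k) (hs : 2 <= s) (hn : s * k + 1 <= n).
Implicit Types (x y z e p q c : 'I_n) (Q R S T U M W C X : {set 'I_n}).
Local Notation vx := (vertex s k).

(** The linear consequence of [hn] left to the arithmetic tactics, which clear the nonlinear
    hypothesis. *)
Lemma double_s_lt_n : 2 * s < n.
Proof. nia. Qed.

(** The conflict relation: two distinct points exclude each other from a vertex exactly when they
    are close. It is reflexive, as [s] is positive. *)
Definition close x y := (cdist x y < s) || (cdist y x < s).

Lemma closeC x y : close x y = close y x.
Proof. by rewrite /close orbC. Qed.

Lemma vxP S : reflect (#|S| = k /\ forall x y, x \in S -> y \in S -> x != y ->
    s <= cdist x y) (vx S).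
Proof.
rewrite /vertex inE; apply: (iffP andP)
  => [[/eqP cS /s_stableP stS]|[cS stS]]; split=> //.
- by move=> x y xS yS /eqP xy; have := stS x y xS yS xy; cyclic.
- exact/eqP.
apply/s_stableP => x y xS yS /eqP xy; have := stS x y xS yS xy.
by have := stS y x yS xS; rewrite eq_sym => /(_ xy); cyclic.
Qed.

Lemma vx_card S : vx S -> #|S| = k.
Proof. by case/vxP. Qed.

Lemma vx_dist S x y : vx S -> x \in S -> y \in S -> x != y -> s <= cdist x y.
Proof. by case/vxP => _; apply. Qed.

Lemma vx_sub S T : vx S -> vx T -> S \subset T -> S = T.
Proof.
by move=> vS vT ST; apply/eqP; rewrite eqEcard ST !vx_card ?leqnn.
Qed.

Lemma vx_close S x y : vx S -> x \in S -> y \in S -> close x y -> x = y.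
Proof.
move=> vS xS yS cxy; apply/eqP; case: eqVneq => // xy.
have := vx_dist vS xS yS xy; have := vx_dist vS yS xS.
by rewrite eq_sym => /(_ xy); move: cxy; rewrite /close; arith.
Qed.

Lemma vx_setU1 R x y : x \notin R -> y \notin R -> vx (x |: R) ->
  (forall e, e \in R -> s <= cdist e y /\ s <= cdist y e) -> vx (y |: R).
Proof.
move=> xR yR vS H; apply/vxP; split.
  by rewrite -(vx_card vS) !cardsU1 xR yR.
move=> a b; rewrite !inE => /predU1P[->|aR] /predU1P[->|bR]; rewrite ?eqxx //.
- by case: (H b bR).
- by case: (H a aR).
by apply: (vx_dist vS); rewrite inE ?aR ?bR orbT.
Qed.

(* One point moves by less than [s] without meeting the others. *)
Inductive slide S T : Prop := Slide R x y of
  x \notin R & y \notin R & x != y & close x y &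
  vx (x |: R) & vx (y |: R) & S = x |: R & T = y |: R.

(* The same relation in terms of the graph only: no third vertex has all common
   neighbours of S and T among its neighbours. *)
Definition slideG S T := [/\ vx S, vx T, S != T, ~~ [disjoint S & T] &
  forall U, vx U ->
    (forall C, vx C -> [disjoint C & S] -> [disjoint C & T] ->
       [disjoint C & U]) -> U = S \/ U = T].

Lemma slide_sym S T : slide S T -> slide T S.
Proof.
case=> R x y xR yR xy cxy vS vT -> ->.
by apply: (@Slide _ _ R y x); rewrite 1?eq_sym 1?closeC.
Qed.

Lemma slideG_sym S T : slideG S T -> slideG T S.
Proof.
case=> vS vT ST mST H; split=> //; rewrite 1?eq_sym 1?disjoint_sym // => U vU HU.
by case: (H U vU) => [C vC CS CT||]; [exact: HU|right|left].
Qed.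

(* Cut the circle at [c]: [p] is the first point where [S] and [T] differ and [q]
   the next point of [T]. *)
Lemma exchange S T c p : vx S -> vx T -> c \in S -> c \in T ->
  p \in S -> p \notin T ->
  (forall z, (z \in S) != (z \in T) -> cdist c p <= cdist c z) ->
  exists q, [/\ q \in T, cdist c p < cdist c q & vx (p |: T :\ q)].
Proof.
move=> vS vT cS cT pS pT pmin.
have below z : cdist c z < cdist c p -> (z \in S) = (z \in T).
  by move=> zp; have := pmin z; case: (z \in S); case: (z \in T) => //= /(_ isT); arith.
have [q0 /andP[q0T q0p]|none] := pickP [pred z | (z \in T) && (cdist c p < cdist c z)].
  (* Without a point of [T] after [p], all of [T] would lie in [S :\ p], which is too small. *)
  2: { have: T \subset S :\ p.
         apply/subsetP => z zT; rewrite !inE; case: eqVneq => [zp|zp].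
           by rewrite -zp zT in pT.
         rewrite below // ltnNge; apply/negP => pz; have := none z; rewrite /= zT /=.
         by move=> /negbT; cyclic.
       move/subset_leq_card => le; exfalso; have := cardsD1 p S.
       move: le; rewrite pS (vx_card vT) (vx_card vS).
       by rewrite add1n => le kE; move: le; rewrite kE ltnn. }
have: [pred z | (z \in T) && (cdist c p < cdist c z)] q0 by rewrite /= q0T q0p.
move=> Pq0; case: (arg_minnP (fun z => cdist c z) Pq0) => q /andP[qT pq] qmin.
exists q; split=> //; apply/vxP; split.
  by rewrite cardsU1 !inE (negbTE pT) andbF -(vx_card vT) [in RHS](cardsD1 q) qT.
(* A point before [p] also lies in [S], as [p] does. A point after [q] is kept away from [p] by [q]
   on one side and by [c] on the other. *)
have main z : z \in T -> z != q -> s <= cdist p z /\ s <= cdist z p.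
  move=> zT zq; have zp : z != p by apply: contraNneq pT => <-.
  case: (ltnP (cdist c z) (cdist c p)) => [zp'|zp'].
    have zS : z \in S by rewrite below.
    by split; apply: (vx_dist vS); rewrite // eq_sym.
  have pz : cdist c p < cdist c z by cyclic.
  have qz := qmin z; rewrite /= zT pz in qz; have {}qz := qz isT.
  have qz' : q != z by rewrite eq_sym.
  have := vx_dist vT qT zT qz'.
  have zc : z != c by apply: contraTneq pz => ->; cyclic.
  have := vx_dist vT zT cT zc; cyclic.
move=> a b; rewrite !inE => /predU1P[->|/andP[aq aT]] /predU1P[->|/andP[bq bT]].
- by rewrite eqxx.
- by case: (main b bT bq).
- by case: (main a aT aq).
exact: (vx_dist vT).
Qed.

(** Whatever avoids [S] and [T] avoids every vertex inside their union, so [slideG] admits no third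
    vertex there. The exchanged set contains [p], hence is [S], and the two sets differ in one point
    only. *)
Lemma slideG_slide_aux S T c p : slideG S T -> c \in S -> c \in T ->
  p \in S -> p \notin T ->
  (forall z, (z \in S) != (z \in T) -> cdist c p <= cdist c z) -> slide S T.
Proof.
case=> vS vT ST _ H cS cT pS pT pmin.
have [q [qT pq vU]] := exchange vS vT cS cT pS pT pmin.
have SE : p |: T :\ q = S.
  case: (H _ vU) => // [C vC CS CT|UT].
    rewrite disjoints_subset; apply/subsetP => z zC; rewrite !inE negb_or.
    rewrite (disjointFr CT zC) andbF andbT.
    by apply: contraFneq (disjointFr CS zC) => ->.
  by move: pT; rewrite -UT !inE eqxx.
have TE : q |: T :\ q = T by apply: setD1K.
have qp : p != q by apply: contraNneq pT => ->.
apply: (@Slide _ _ (T :\ q) p q); rewrite ?TE ?SE ?inE ?eqxx ?(negbTE pT) ?andbF //.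
apply/negPn/negP => ncl.
have cq : c != q by apply: contraTneq pq => <-; cyclic.
have cp : c != p by apply: contraNneq pT => <-.
(* If [p] and [q] were not close, [p |: T] would be stable with one point too many; dropping the
   common point [c] would give a third vertex inside the union. *)
have vV : vx ((p |: T) :\ c).
  apply/vxP; split.
    have := cardsD1 c (p |: T).
    by rewrite cardsU1 pT !inE cT orbT (vx_card vT) !add1n => -[<-].
  have main z : z \in T -> s <= cdist p z /\ s <= cdist z p.
    move=> zT; have zp : z != p by apply: contraNneq pT => <-.
    have [zq|zq] := eqVneq z q; first by move: ncl; rewrite zq /close; arith.
    have zS : z \in S by rewrite -SE !inE zq zT orbT.
    by split; apply: (vx_dist vS); rewrite // eq_sym.
  move=> a b; rewrite !inE => /andP[_ /predU1P[->|aT]] /andP[_ /predU1P[->|bT]].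
  - by rewrite eqxx.
  - by case: (main b bT).
  - by case: (main a aT).
  exact: (vx_dist vT).
case: (H _ vV) => [C vC CS CT|E|E].
- rewrite disjoints_subset; apply/subsetP => z zC; rewrite !inE negb_and negb_or.
  rewrite (disjointFr CT zC) andbT; apply/orP; right.
  by apply: contraFneq (disjointFr CS zC) => ->.
- by move: cS; rewrite -E !inE eqxx.
by move: cT; rewrite -E !inE eqxx.
Qed.

Lemma slideG_slide S T : slideG S T -> slide S T.
Proof.
move=> G; case: (G) => vS vT ST mST _.
have [c /andP[cS cT]] : exists c, (c \in S) && (c \in T).
  by move: mST; rewrite -setI_eq0 => /set0Pn[c]; rewrite inE; exists c.
have [p0 Pp0] : exists p0, (p0 \in S) != (p0 \in T).
  apply/existsP; apply: contraNT ST => /existsPn H; apply/eqP/setP => z.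
  by have := H z; case: (z \in S); case: (z \in T).
case: (@arg_minnP _ p0 (fun z => (z \in S) != (z \in T)) (cdist c) Pp0) => p Pp pmin.
case: (boolP (p \in S)) Pp => pS /= pT.
  by apply: (slideG_slide_aux G cS cT pS) => //; case: (p \in T) pT.
have {}pT : p \in T by case: (p \in T) pT.
apply: slide_sym; apply: (slideG_slide_aux (slideG_sym G) cT cS pT pS).
by move=> z zz; apply: pmin; rewrite /= eq_sym.
Qed.

(** The last hypothesis says that the gap from [x] to [y] is still at least [s] after both have
    moved forward. *)
Lemma vx_shift S (tau : 'I_n -> nat) : vx S ->
  {in S, forall x, tau x < n} ->
  {in S &, forall x y, x != y -> tau x + s <= cdist x y + tau y} ->
  vx [set shift (tau e) e | e in S].
Proof.
move=> vS tn H.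
have main x y : x \in S -> y \in S -> x != y ->
    s <= cdist (shift (tau x) x) (shift (tau y) y).
  move=> xS yS xy; have := H _ _ xS yS xy; have := H _ _ yS xS.
  rewrite eq_sym => /(_ xy); have := tn _ xS; have := tn _ yS; have := double_s_lt_n.
  by cyclic.
apply/vxP; split.
  rewrite card_in_imset ?(vx_card vS) // => x y xS yS E; apply/eqP.
  by apply/negPn/negP => xy; have := main x y xS yS xy; rewrite E; cyclic.
move=> _ _ /imsetP[x xS ->] /imsetP[y yS ->] xy; apply: main => //.
by apply: contraNneq xy => ->.
Qed.

Lemma vx_other S x : vx S -> exists2 y, y \in S & y != x.
Proof.
move=> vS; have : 0 < #|S :\ x|.
  have := vx_card vS; rewrite (cardsD1 x) => E.
  by rewrite -(ltn_add2l (x \in S)) E addn0; case: (x \in S); arith.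
by rewrite card_gt0 => /set0Pn[y]; rewrite !inE => /andP[yx yS]; exists y.
Qed.

(** Every point moves, but stops short of the next point of [S]. *)
Lemma shift_disjoint S (tau : 'I_n -> nat) : vx S ->
  {in S, forall x, 0 < tau x} ->
  {in S &, forall x y, x != y -> tau x < cdist x y} ->
  [disjoint [set shift (tau e) e | e in S] & S].
Proof.
move=> vS t0 H; rewrite disjoints_subset; apply/subsetP => _ /imsetP[x xS ->].
(* A second point bounds [tau x] below [n], so that [x] cannot come back to itself. *)
have [y yS yx] := vx_other x vS; rewrite inE; apply/negP => zS.
have := t0 _ xS; have := H _ _ xS yS; have := H _ _ xS zS.
rewrite eq_sym in yx; move=> h /(_ yx) h1 h2.
have xz : x != shift (tau x) x by cyclic.
by have := h xz; cyclic.
Qed.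

Lemma pred_exists S z : vx S ->
  exists2 p, p \in S & {in S, forall e, cdist p z <= cdist e z}.
Proof.
move=> vS; have [p0 p0S _] := vx_other z vS.
by case: (arg_minnP (fun e => cdist e z) p0S) => p pS pmin; exists p.
Qed.

(* Shift every point of x |: R by min(u, s - 1), where u is the distance from z
   back to its predecessor p; p moves to z itself, and x goes one step further
   if it would land on y. *)
Lemma covering R x y z : x \notin R -> y \notin R ->
  vx (x |: R) -> vx (y |: R) -> x != y -> cdist x y < s ->
  z != x -> z != y -> z \notin R ->
  exists C, [/\ vx C, z \in C, [disjoint C & x |: R] & [disjoint C & y |: R]].
Proof.
move=> xR yR vS vT xy xys zx zy zR; set S := x |: R in vS *.
have [p pS pmin] := pred_exists z vS.
have zS : z \notin S by rewrite !inE negb_or zx.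
have pz : p != z by apply: contraNneq zS => <-.
set u := cdist p z; set m := minn u s.-1; set t := cdist x y in xys.
have t0 : 0 < t by rewrite /t; cyclic.
have u0 : 0 < u by rewrite /u; cyclic.
pose tau e := if e == p then u else if (e == x) && (m == t) then t.+1 else m.
have pgap e : e \in S -> p != e -> u < cdist p e.
  by move=> eS pe; have := pmin e eS; rewrite /u; cyclic.
(* As [y |: R] is stable too, [x] has [t] units of extra room; this permits the additional move by
   one. *)
have xgap e : e \in S -> x != e -> t + s <= cdist x e.
  move=> eS xe; have eR : e \in R by move: eS; rewrite !inE eq_sym (negbTE xe).
  have ye : y != e by apply: contraNneq yR => ->.
  have := vx_dist vT (setU11 y R) (setU1r y eR) ye.
  have ey : e != y by rewrite eq_sym.
  have := vx_dist vT (setU1r y eR) (setU11 y R) ey.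
  have := vx_dist vS (setU11 x R) eS xe; rewrite /t; cyclic.
have taum e : m <= tau e.
  by rewrite /tau; case: ifP => _; [arith|case: ifP => [/andP[_ /eqP]|]; arith].
have H : {in S &, forall a b, a != b -> tau a < cdist a b}.
  move=> a b aS bS ab; have := vx_dist vS aS bS ab; rewrite /tau.
  case: eqP => [ap|_]; first by move=> _; rewrite ap; apply: pgap => //; rewrite -ap.
  case: ifP => [/andP[/eqP ax _] _|_]; last by arith.
  by have := xgap b bS; rewrite -ax => /(_ ab); arith.
have H' : {in S &, forall a b, a != b -> tau a + s <= cdist a b + tau b}.
  move=> a b aS bS ab; have := vx_dist vS aS bS ab; have := taum b; rewrite {2}/tau.
  case: eqP => [ap|_].
    by have := pgap b bS; rewrite ap in ab * => /(_ ab); arith.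
  case: ifP => [/andP[/eqP ax /eqP mt]|_]; last by arith.
  by have := xgap b bS; rewrite -ax => /(_ ab); arith.
have tn : {in S, forall e, tau e < n}.
  move=> e eS; have [b bS] := vx_other e vS; rewrite eq_sym => be.
  by have := H _ _ eS bS be; cyclic.
have t1 : {in S, forall e, 0 < tau e} by move=> e _; have := taum e; arith.
exists [set shift (tau e) e | e in S]; split; first exact: vx_shift.
- apply/imsetP; exists p => //; rewrite /tau eqxx /u; cyclic.
- exact: shift_disjoint.
have dS := shift_disjoint vS t1 H.
rewrite disjoints_subset; apply/subsetP => w wC; have wS := disjointFr dS wC.
rewrite !inE negb_or; move: (wS); rewrite !inE => /norP[_ ->]; rewrite andbT.
case/imsetP: wC => e eS wE; apply/negP => /eqP wy.
have te : tau e = cdist e y by rewrite -wy wE; have := tn _ eS; cyclic.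
(* Nothing lands on [y]: [p] lands on [z], [x] moves by something other than [t], and any other
   point moves by less than [s], its least distance to [y]. *)
move: eS; rewrite !inE => /predU1P[ex|eR].
  move: te; rewrite ex -/t /tau eqxx /=; case: eqP => [xp ut|_].
    by move: zy; rewrite -wy wE ex /tau xp eqxx /u; cyclic.
  by case: eqP; arith.
have ey : e != y by apply: contraNneq yR => <-.
have := vx_dist vT (setU1r y eR) (setU11 y R) ey.
move: te; rewrite /tau; case: eqP => [ep ut|_].
  by move: zy; rewrite -wy wE /tau ep eqxx /u; cyclic.
case: ifP => [/andP[/eqP ex _]|_]; last by arith.
by move: xR; rewrite -ex eR.
Qed.

(** By [covering], a vertex [U] as in [slideG] has no point outside [S] and [T]; since [x] and [y]
    are close it lacks one of them, so it is contained in [S] or in [T]. *)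
Lemma slide_slideG S T : slide S T -> slideG S T.
Proof.
case=> R x y; wlog xys : S T x y / cdist x y < s.
  move=> H xR yR xy cxy vS vT SE TE; move: (cxy); rewrite /close => /orP[h|h].
    exact: (H S T x y).
  by apply: slideG_sym; apply: (H T S y x); rewrite // 1?eq_sym 1?closeC.
move=> xR yR xy cxy vS vT -> ->; split=> //.
- by apply: contraNneq xR => E; have := setU11 x R; rewrite E !inE (negbTE xy).
- have [e] := vx_other x vS; rewrite !inE => /predU1P[->|eR _]; rewrite ?eqxx //.
  by rewrite -setI_eq0; apply/set0Pn; exists e; rewrite !inE eR !orbT.
move=> U vU H.
have sub z : z \in U -> [|| z == x, z == y | z \in R].
  move=> zU; apply/negPn/negP; rewrite !negb_or => /and3P[zx zy zR].
  have [C [vC zC CS CT]] := covering xR yR vS vT xy xys zx zy zR.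
  by rewrite (disjointFr (H C vC CS CT) zC) in zU.
case: (boolP (y \in U)) => yU; [right|left]; apply: vx_sub => //;
  apply/subsetP => z zU; have := sub z zU; rewrite !inE.
  case: eqVneq => [zx|_ //].
  by move: xy; rewrite -(vx_close vU _ yU cxy) ?eqxx // -zx.
by case: (eqVneq z y) => [zy|//]; rewrite zy (negbTE yU) in zU.
Qed.

(** * Triangles and squares formed by slides *)

Lemma slide_vx S T : slide S T -> vx S /\ vx T.
Proof. by case=> R x y _ _ _ _ vS vT -> ->. Qed.

Lemma slide_neq S T : slide S T -> S != T.
Proof. by move=> /slide_slideG[]. Qed.

Lemma slide_out S T a b : slide S T -> a \in S -> a \notin T -> b \in S ->
  b \notin T -> a = b.
Proof.
case=> R x y xR yR xy _ _ _ -> ->; rewrite !inE !negb_or.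
by move=> /predU1P[->|->] /andP[_ //] _ /predU1P[->|->] /andP[_].
Qed.

Lemma slide_close S T a b : slide S T -> a \in S -> a \notin T -> b \in T ->
  b \notin S -> close a b.
Proof.
case=> R x y xR yR xy cxy _ _ -> ->; rewrite !inE !negb_or.
by move=> /predU1P[->|->] /andP[_ //] _ /predU1P[->|->] /andP[_].
Qed.

Lemma slide_setU1 R x y : x \notin R -> y \notin R -> x != y -> close x y ->
  vx (x |: R) -> vx (y |: R) -> slide (x |: R) (y |: R).
Proof. by move=> xR yR xy cxy vS vT; apply: (@Slide _ _ R x y). Qed.

(** Three mutually related vertices all move the same point. If [x] were in [U], then [y] would not
    be, and [U] would miss both [y] and a point of [R] from [y |: R], too many for one slide. *)
Lemma slide_triangle R x y U : x \notin R -> y \notin R -> x != y ->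
  close x y -> slide U (x |: R) -> slide U (y |: R) ->
  exists v, [/\ v \notin R, U = v |: R, v != x, v != y & close v x && close v y].
Proof.
move=> xR yR xy cxy US UT; have [vU vS] := slide_vx US; have [_ vT] := slide_vx UT.
have xT : x \notin y |: R by rewrite !inE negb_or xy.
have yS : y \notin x |: R by rewrite !inE negb_or eq_sym xy.
have xU : x \notin U.
  apply/negP => xU; have yU : y \notin U.
    by apply: contra_neqN xy => yU; apply: (vx_close vU).
  case: (slide_sym US) => R' a b aR' bR' ab _ _ _ SE UE.
  have aU : a \notin U by rewrite UE !inE negb_or ab.
  have aR : a \in R.
    have: a \in x |: R by rewrite SE setU11.
    by rewrite !inE => /predU1P[ax|//]; rewrite ax xU in aU.
  have := slide_out (slide_sym UT) (setU1r y aR) aU (setU11 y R) yU.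
  by move=> ay; rewrite -ay aR in yR.
case: (US) => R' v a vR' aR' va cva _ _ UE SE.
have ax : x = a.
  have: x \in a |: R' by rewrite -SE setU11.
  by rewrite !inE => /predU1P[//|xR']; rewrite UE !inE xR' orbT in xU.
have RE : R' = R.
  by rewrite -(setU1K aR') -SE -ax setU1K.
rewrite RE in UE vR'; exists v; rewrite ax cva va; split=> //=.
  by apply: contraNneq (slide_neq UT) => vy; rewrite UE vy.
have vinU : v \in U by rewrite UE setU11.
have yU : y \notin U.
  rewrite UE !inE negb_or yR andbT; apply: contraNneq (slide_neq UT) => yv.
  by rewrite UE yv.
apply: (slide_close UT vinU _ (setU11 y R) yU).
rewrite !inE negb_or vR' andbT; apply: contraNneq yU => <-; exact: vinU.
Qed.

(** If [W] misses [y], that is its only loss, so [W] contains [M :\ x] and in particular [x']. Hence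
    it misses [y'] and contains [M :\ x'] as well. *)
Lemma slide_square M x y x' y' W : vx M -> x \in M -> x' \in M -> x != x' ->
  y \notin M -> y' \notin M -> close x y -> close x' y' ->
  slide W (y |: M :\ x) -> slide W (y' |: M :\ x') ->
  W = M \/ (y \in W) && (y' \in W).
Proof.
move=> vM xM x'M xx' yM y'M cxy cxy' WS WU; have [vW _] := slide_vx WS.
have half a b a' b' : a \in M -> a' \in M -> a != a' -> b \notin M -> b' \notin M ->
    close a b -> close a' b' ->
    slide W (b |: M :\ a) -> slide W (b' |: M :\ a') -> b \notin W -> W = M.
  move=> aM a'M aa' bM b'M cab cab' Wa Wa' bW.
  have sub c d : slide W (d |: M :\ c) -> d \notin M -> d \notin W -> M :\ c \subset W.
    move=> Wd dM dW; apply/subsetP => z zM; apply/negPn/negP => zW.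
    have := slide_out (slide_sym Wd) (setU1r d zM) zW (setU11 d _) dW => zd.
    by move: zM; rewrite zd !inE (negbTE dM) andbF.
  have Ma := sub _ _ Wa bM bW.
  have a'W : a' \in W by apply: (subsetP Ma); rewrite !inE eq_sym aa'.
  have b'W : b' \notin W.
    apply/negP => b'W; move: b'M; rewrite -(vx_close vW a'W b'W cab') a'M //.
  have Ma' := sub _ _ Wa' b'M b'W; apply/esym/vx_sub => //; apply/subsetP => z zM.
  have [->|za] := eqVneq z a; first by apply: (subsetP Ma'); rewrite !inE aa'.
  by apply: (subsetP Ma); rewrite !inE za.
case: (boolP (y \in W)) => yW; last first.
  by left; apply: (half x y x' y').
case: (boolP (y' \in W)) => y'W; first by right.
by left; apply: (half x' y' x y) => //; rewrite eq_sym.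
Qed.

(** Two independent moves out of [M] have a unique fourth corner: [W] contains [y'], so not [x'],
    which is therefore the one point lost. *)
Lemma slide_square_corner M x y x' y' W : vx M -> x \in M -> x' \in M ->
  x != x' -> y \notin M -> y' \notin M -> close x y -> close x' y' ->
  slide W (y |: M :\ x) -> slide W (y' |: M :\ x') -> W <> M ->
  W = y' |: (y |: M :\ x) :\ x'.
Proof.
move=> vM xM x'M xx' yM y'M cxy cxy' WS WU WM; have [vW vS] := slide_vx WS.
have [//|/andP[yW y'W]] := slide_square vM xM x'M xx' yM y'M cxy cxy' WS WU.
have x'S : x' \in y |: M :\ x by rewrite !inE (eq_sym x' x) xx' x'M orbT.
have x'W : x' \notin W.
  by apply: contra y'M => x'W; rewrite -(vx_close vW x'W y'W cxy').
have yS : y' \notin y |: M :\ x.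
  rewrite !inE negb_or (negbTE y'M) andbF andbT; apply: contraNneq yM => y'y.
  by rewrite -y'y -(vx_close vS x'S _ cxy') // y'y setU11.
apply/esym/eqP; rewrite eqEcard; apply/andP; split.
  apply/subsetP => z /setU1P[->//|/setD1P[zx' zS]].
  apply/negPn/negP => zW; move: zx'.
  by rewrite (slide_out (slide_sym WS) zS zW x'S x'W) eqxx.
rewrite cardsU1 !inE (negbTE (_ : ~~ ((y' != x') && _))) ?(vx_card vW); last first.
  by rewrite negb_and; move: yS; rewrite !inE => ->; rewrite orbT.
by have := cardsD1 x' (y |: M :\ x); rewrite x'S (vx_card vS) => <-.
Qed.

(* Graph-theoretic betweenness of three positions of the same point: (a) what is
   close to the outer positions is close to the middle one; (b) no move of
   another point that is possible in the middle is blocked at both ends. *)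
Definition between S M T := [/\ slide S M, slide M T, slide S T,
  forall U, slide U S -> slide U T -> U = M \/ slide U M &
  forall U, slide U M -> ~ slide U S -> ~ slide U T -> U <> S -> U <> T ->
    exists2 W, W <> M & slide W U /\ (slide W S \/ slide W T)].

Lemma between_sym S M T : between S M T -> between T M S.
Proof.
case=> SM MT ST H1 H2; split; try exact: slide_sym; first by move=> U h1 h2; exact: H1.
move=> U UM UT US nT nS; case: (H2 U UM US UT nS nT) => W WM [WU h].
by exists W => //; split=> //; case: h; [right|left].
Qed.

(** Let [e] be the next point of [R] after [m]. If there is room, moving [m] to [v] gives a position
    close to [a] and [b] but not to [m], against (a). Otherwise [e] can be moved back to [v] while
    [m] is present, but neither [a] nor [b] tolerates [v], against (b). *)
Lemma not_between_outer R m a b : m \notin R -> a \notin R -> b \notin R ->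
  vx (m |: R) -> vx (a |: R) -> vx (b |: R) ->
  0 < cdist m a < cdist m b -> cdist m b < s ->
  ~ between (a |: R) (m |: R) (b |: R).
Proof.
move=> mR aR bR vM vS vT mab mbs [SM MT ST H1 H2].
have ns := double_s_lt_n.
have [e0 e0R] : exists e0, e0 \in R.
  have [e] := vx_other m vM; rewrite !inE => /predU1P[->|eR _]; rewrite ?eqxx //.
  by exists e.
case: (arg_minnP (fun e => cdist m e) e0R) => e eR emin.
have inU1 v z : z \in R -> z \in v |: R by apply: setU1r.
have far v z : vx (v |: R) -> v \notin R -> z \in R -> s <= cdist v z /\ s <= cdist z v.
  move=> vv vR zR; have vz : v != z by apply: contraNneq vR => ->.
  by split; apply: (vx_dist vv); rewrite ?setU11 ?inU1 // eq_sym.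
have [bel1 bel2] := far b e vT bR eR.
have [mel1 mel2] := far m e vM mR eR.
have Eb : cdist m b + s <= cdist m e by cyclic_at m.
(* The first position ahead of [m] that is not close to it. *)
have [v vm] : exists v, cdist m v = s by exists (shift s m); cyclic.
have vnm : v != m by cyclic_at m.
have vncm : ~~ close v m by rewrite /close; cyclic_at m.
case: (leqP (2 * s) (cdist m e)) => Es.
  have vR : v \notin R by apply/negP => /emin; cyclic_at m.
  have vV : vx (v |: R).
    apply: (vx_setU1 mR vR vM) => z zR; have := emin z zR.
    have := far m z vM mR zR; cyclic_at m.
  have va : v != a by cyclic_at m.
  have vb : v != b by cyclic_at m.
  have Va : slide (v |: R) (a |: R).
    by apply: slide_setU1 => //; rewrite /close; cyclic_at m.
  have Vb : slide (v |: R) (b |: R).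
    by apply: slide_setU1 => //; rewrite /close; cyclic_at m.
  have vM' : v \notin m |: R by rewrite !inE negb_or vnm.
  case: (H1 _ Va Vb) => [E|VM]; first by rewrite -E setU11 in vM'.
  have mV : m \notin v |: R by rewrite !inE negb_or eq_sym vnm.
  by have := slide_close VM (setU11 v R) vM' (setU11 m R) mV; apply/negP.
have me : m != e by apply: contraNneq mR => ->.
have ve : v != e by cyclic_at m.
have vR : v \notin R by apply/negP => /emin; cyclic_at m.
have vM' : v \notin m |: R by rewrite !inE negb_or vnm.
have eM : e \in m |: R by rewrite inU1.
pose Q := (m |: R) :\ e; have eQ : e \notin Q by rewrite !inE eqxx.
have ME : m |: R = e |: Q by rewrite /Q setD1K.
have vQ : v \notin Q by rewrite !inE (negbTE vnm) (negbTE vR) andbF.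
have cev : close e v by rewrite /close; cyclic_at m.
have vV : vx (v |: Q).
  apply: (vx_setU1 eQ vQ); rewrite -?ME // => z.
  rewrite !inE => /andP[ze /predU1P[->|zR]]; first by rewrite vm; cyclic_at m.
  have := emin z zR; have := far m z vM mR zR.
  have := vx_dist vM eM (inU1 m z zR); rewrite eq_sym => /(_ ze).
  by cyclic_at m.
have UM : slide (v |: Q) (m |: R).
  by rewrite ME; apply: slide_setU1; rewrite -?ME // 1?eq_sym 1?closeC //; cyclic_at m.
have mU : m \in v |: Q by rewrite !inE eqxx me orbT.
have vU : v \in v |: Q by rewrite setU11.
have off w : w != m -> w != v -> ~ slide (v |: Q) (w |: R).
  move=> wm wv Uw; have := slide_out Uw mU _ vU => h.
  have := h; rewrite !inE !negb_or mR vR eq_sym wm eq_sym wv => /(_ isT isT) mv.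
  by rewrite mv eqxx in vnm.
have offE w : w != m -> v |: Q <> w |: R.
  by move=> wm E; move: mU; rewrite E !inE eq_sym (negbTE wm) (negbTE mR).
have am : a != m by cyclic_at m.
have bm : b != m by cyclic_at m.
have av : a != v by cyclic_at m.
have bv : b != v by cyclic_at m.
have [W WM [WU WST]] := H2 _ UM (off a am av) (off b bm bv) (offE a am) (offE b bm).
have sq w : w \notin R -> w != m -> w != v -> close m w -> close w v ->
    slide W (w |: R) -> False.
  move=> wR wm wv cmw cwv Ww; have [vW _] := slide_vx Ww.
  have mRE : (m |: R) :\ m = R by rewrite setU1K.
  have wM : w \notin m |: R by rewrite !inE negb_or wm.
  have := @slide_square (m |: R) m w e v W vM (setU11 m R) eM me wM vM' cmw cev.
  rewrite mRE => /(_ Ww WU)[//|/andP[wW vW']].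
  by move: wv; rewrite (vx_close vW wW vW' cwv) eqxx.
case: WST => h; [apply: (sq a) h|apply: (sq b) h] => //; rewrite /close; cyclic_at m.
Qed.

(** For (a), [slide_triangle] reduces [U] to a position of the same point, and a point [e] of [R]
    makes the outer arc too long for a position close to both ends but not to [m]. For (b), a moved
    point not close to [m] cannot be close to both ends. *)
Lemma between_inner R x m y : x \notin R -> m \notin R -> y \notin R ->
  vx (x |: R) -> vx (m |: R) -> vx (y |: R) ->
  0 < cdist x m < cdist x y -> cdist x y < s ->
  between (x |: R) (m |: R) (y |: R).
Proof.
move=> xR mR yR vS vM vT xmy xys.
have ns := double_s_lt_n.
have [e eR] : exists e, e \in R.
  have [e] := vx_other m vM; rewrite !inE => /predU1P[->|eR _]; rewrite ?eqxx //.
  by exists e.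
have inU1 v z : z \in R -> z \in v |: R by apply: setU1r.
have far v z : vx (v |: R) -> v \notin R -> z \in R -> s <= cdist v z /\ s <= cdist z v.
  move=> vv vR zR; have vz : v != z by apply: contraNneq vR => ->.
  by split; apply: (vx_dist vv); rewrite ?setU11 ?inU1 // eq_sym.
have xm : x != m by cyclic_at x.
have my : m != y by cyclic_at x.
have xy : x != y by cyclic_at x.
have cxy : close x y by rewrite /close xys.
split.
- by apply: slide_setU1 => //; rewrite /close; cyclic_at x.
- by apply: slide_setU1 => //; rewrite /close; cyclic_at x.
- by apply: slide_setU1.
- move=> U US UT.
  have [v [vR UE vx' vy /andP[cvx cvy]]] :=
    slide_triangle xR yR xy cxy US UT.
  have [vm|vm] := eqVneq v m; first by left; rewrite UE vm.
  right; rewrite UE; have [vU _] := slide_vx US; rewrite UE in vU.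
  apply: slide_setU1 => //; have := far x e vS xR eR; have := far y e vT yR eR.
  by move: cvx cvy; rewrite /close; cyclic_at x.
move=> U UM US UT nS nT; have [vU _] := slide_vx UM.
case: UM => Q q p qQ pQ qp cqp _ _ UE ME.
have [pm|pm] := eqVneq p m.
  have QE : Q = R by rewrite -(setU1K pQ) -ME pm setU1K.
  exfalso; rewrite QE in UE qQ.
  have qx : q != x by apply/eqP => qx; apply: nS; rewrite UE qx.
  have qy : q != y by apply/eqP => qy; apply: nT; rewrite UE qy.
  have nqx : ~~ close q x.
    by apply/negP => c; apply: US; rewrite UE; apply: slide_setU1; rewrite -?UE.
  have nqy : ~~ close q y.
    by apply/negP => c; apply: UT; rewrite UE; apply: slide_setU1; rewrite -?UE.
  by move: cqp nqx nqy; rewrite pm /close; cyclic_at x.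
have pR : p \in R.
  by have: p \in m |: R; [rewrite ME setU11|rewrite !inE (negbTE pm)].
have mU : m \in U.
  have: m \in p |: Q by rewrite -ME setU11.
  by rewrite !inE eq_sym (negbTE pm) /= => mQ; rewrite UE !inE mQ orbT.
have qM : q \notin m |: R by rewrite ME !inE negb_or qp.
have qm : q != m by apply: contraNneq qM => ->; rewrite setU11.
have qR : q \notin R by move: qM; rewrite !inE negb_or => /andP[].
have qU : q \in U by rewrite UE setU11.
have mq1 := vx_dist vU qU mU qm; have mq2 := vx_dist vU mU qU.
rewrite eq_sym in mq2; have {}mq2 := mq2 qm.
(* The witness [W] performs both moves, [p] to [q] and [m] to the end [w] that does not conflict
   with [q]. *)
have main w : w \notin R -> vx (w |: R) -> w != m -> close w m ->
    ~~ close q w -> q != w ->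
    exists2 W, W <> m |: R & slide W U /\ slide W (w |: R).
  move=> wR vw wm cwm nqw qw; pose P := R :\ p.
  have PE : p |: P = R by rewrite /P setD1K.
  have pP : p \notin P by rewrite !inE eqxx.
  have UE' : U = m |: (q |: P).
    rewrite UE setUCA; congr (_ |: _); apply/setP => z.
    have := congr1 (fun A : {set _} => z \in A) ME; rewrite !inE.
    have [->|_ /= <- //] := eqVneq z p; by rewrite (negbTE pm) (negbTE pQ).
  have wq : w != q by rewrite eq_sym.
  have mP : m \notin q |: P by rewrite !inE negb_or eq_sym qm (negbTE mR) andbF.
  have wP : w \notin q |: P by rewrite !inE negb_or wq (negbTE wR) andbF.
  have vW : vx (w |: (q |: P)).
    apply: (vx_setU1 mP wP); rewrite -?UE' // => z; rewrite !inE.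
    case/predU1P=> [->|/andP[_ zR]]; last by case: (far w z vw wR zR).
    by move: nqw; rewrite /close negb_or -!leqNgt => /andP[].
  exists (w |: (q |: P)); first by move=> E; move: qM; rewrite -E !inE eqxx orbT.
  split; first by rewrite UE'; apply: slide_setU1; rewrite -?UE'.
  have pw : p != w by apply: contraNneq wR => <-.
  have wRE : w |: R = p |: (w |: P) by rewrite -PE setUCA.
  rewrite setUCA wRE; apply: slide_setU1; rewrite -?wRE // 1?setUCA //.
    by rewrite !inE !negb_or qw (negbTE qR) andbF.
  by rewrite !inE negb_or pw eqxx.
have nself z : ~~ close q z -> q != z.
  by apply: contraNneq => ->; rewrite /close cdist_self; arith.
case: (boolP (close q x)) => cqx; last first.
  have cxm : close x m by rewrite /close; cyclic_at x.
  have [W WM [WU WS]] := main x xR vS xm cxm cqx (nself x cqx).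
  by exists W => //; split; [|left].
case: (boolP (close q y)) => cqy; last first.
  have cym : close y m by rewrite /close; cyclic_at x.
  have ym : y != m by rewrite eq_sym.
  have [W WM [WU WS]] := main y yR vT ym cym cqy (nself y cqy).
  by exists W => //; split; [|right].
(* Here [q] would be less than [s] ahead of [y] and less than [s] behind [x], but [p] forces the arc
   from [y] to [x] to have length at least [2 * s]. *)
exfalso; have := far x p vS xR pR; have := far y p vT yR pR.
by move: cqx cqy; rewrite /close; cyclic_at x.
Qed.

(** * Automorphisms preserve slides and steps *)

Lemma vx_closeP S :
  reflect (#|S| = k /\ {in S &, forall x y, close x y -> x = y}) (vx S).
Proof.
apply: (iffP idP) => [vS|[cS H]].
  by split; [exact: vx_card | move=> x y; exact: vx_close].
apply/vxP; split=> // x y xS yS; apply: contraNT; rewrite -ltnNge => h.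
by apply/eqP/H => //; rewrite /close h.
Qed.

(** A graph automorphism with its inverse, as maps on all sets constrained only on vertices; this
    avoids the subtype until the end. *)
Definition autom (F G : {set 'I_n} -> {set 'I_n}) :=
  [/\ forall S, vx S -> vx (F S) /\ vx (G S),
      forall S, vx S -> G (F S) = S,
      forall S, vx S -> F (G S) = S &
      forall S T, vx S -> vx T -> [disjoint F S & F T] = [disjoint S & T]].

Lemma autom_sym F G : autom F G -> autom G F.
Proof.
case=> FG FK GK FD; split=> // [S vS|S T vS vT]; first by case: (FG S vS).
have [_ vGS] := FG S vS; have [_ vGT] := FG T vT.
by rewrite -FD ?GK.
Qed.

Lemma autom_slide F G S T : autom F G -> slide S T -> slide (F S) (F T).
Proof.
move=> [FG FK GK FD] /slide_slideG [vS vT ST mST H]; apply: slideG_slide.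
have [vFS _] := FG S vS; have [vFT _] := FG T vT; split=> //.
- by apply: contraNneq ST => /(congr1 G); rewrite !FK // => ->.
- by rewrite FD.
move=> U vU HU; have [_ vGU] := FG U vU.
case: (H (G U) vGU) => [C vC CS CT|<-|<-]; [|by left; rewrite GK|by right; rewrite GK].
have [vFC _] := FG C vC.
by rewrite -FD // GK //; apply: HU; rewrite ?FD.
Qed.

Lemma autom_between F G S M T : autom F G -> between S M T ->
  between (F S) (F M) (F T).
Proof.
move=> a [SM MT ST H1 H2]; have [FG FK GK _] := a.
have [vS vM] := slide_vx SM; have [_ vT] := slide_vx ST.
have pull U X : vx X -> slide U (F X) -> slide (G U) X.
  by move=> vX /(autom_slide (autom_sym a)); rewrite FK.
have push U X : vx U -> slide (G U) X -> slide U (F X).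
  by move=> vU /(autom_slide a); rewrite GK.
split; try exact: (autom_slide a).
  move=> U US UT; have [vU _] := slide_vx US.
  case: (H1 (G U)); [exact: pull|exact: pull|by move=> <-; left; rewrite GK|].
  by right; apply: push.
move=> U UM US UT nS nT; have [vU _] := slide_vx UM.
case: (H2 (G U)).
- exact: pull.
- by move=> h; apply: US; apply: push.
- by move=> h; apply: UT; apply: push.
- by move=> h; apply: nS; rewrite -h GK.
- by move=> h; apply: nT; rewrite -h GK.
move=> W WM [WU WST]; have [vW _] := slide_vx WU; exists (F W).
  by move=> h; apply: WM; rewrite -(FK W vW) h FK.
split; first by rewrite -(GK U vU); apply: (autom_slide a).
by case: WST => h; [left|right]; apply: (autom_slide a).
Qed.

Lemma imset_vx (phi : 'I_n -> 'I_n) S : injective phi ->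
  {mono phi : x y / close x y} -> vx S -> vx (phi @: S).
Proof.
move=> inj iso vS; apply/vx_closeP; split; first by rewrite card_imset ?vx_card.
move=> _ _ /imsetP[x xS ->] /imsetP[y yS ->]; rewrite iso => cxy.
by rewrite (vx_close vS xS yS cxy).
Qed.

Lemma imset_autom (phi psi : 'I_n -> 'I_n) : cancel phi psi -> cancel psi phi ->
  {mono phi : x y / close x y} ->
  autom (fun S => phi @: S) (fun S => psi @: S).
Proof.
move=> phiK psiK iso.
have iso' : {mono psi : x y / close x y} by move=> x y; rewrite -iso !psiK.
have [inj inj'] := (can_inj phiK, can_inj psiK); split.
- by move=> S vS; split; apply: imset_vx.
- by move=> S _; rewrite -imset_comp (eq_imset _ phiK) imset_id.
- by move=> S _; rewrite -imset_comp (eq_imset _ psiK) imset_id.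
by move=> S T _ _; rewrite -!setI_eq0 -imsetI ?imset_eq0 // => x y _ _; apply: inj.
Qed.

Lemma mirrorK a : a < n -> involutive (@mirror n a).
Proof. by move=> an x; cyclic. Qed.

Lemma cdist_mirror a x y : a < n -> cdist (mirror a x) (mirror a y) = cdist y x.
Proof. by move=> an; cyclic. Qed.

Lemma close_mirror a : a < n -> {mono (@mirror n a) : x y / close x y}.
Proof. by move=> an x y; rewrite /close !cdist_mirror // orbC. Qed.

Lemma mirror_autom a : a < n ->
  autom (fun S => @mirror n a @: S) (fun S => @mirror n a @: S).
Proof.
by move=> an; apply: imset_autom; [exact: mirrorK..|exact: close_mirror].
Qed.

(** Directed, for use in proofs; an automorphism may reverse the direction, so only the symmetric
    [step] is an invariant. *)
Definition fstep S T := exists R x, [/\ x \notin R, shift 1 x \notin R &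
  [/\ vx (x |: R), vx (shift 1 x |: R), S = x |: R & T = shift 1 x |: R]].

Definition step S T := fstep S T \/ fstep T S.

Lemma step_sym S T : step S T -> step T S.
Proof. by case; [right|left]. Qed.

Lemma cdist_shift1 x : cdist x (shift 1 x) = 1.
Proof. by have := double_s_lt_n; cyclic. Qed.

Lemma cdist_eq_shift x y t : cdist x y = t -> y = shift t x.
Proof. by move=> <-; set t0 := cdist x y; have : t0 = cdist x y by []; cyclic. Qed.

Lemma fstep_slide S T : fstep S T -> slide S T.
Proof.
case=> R [x [xR yR [vS vT -> ->]]]; apply: slide_setU1 => //.
  by have := cdist_shift1 x; cyclic_at x.
by rewrite /close cdist_shift1 hs.
Qed.

(** A vertex in between would put the moving point at some [v] close to both [x] and its successor,
    hence behind or ahead of the pair; [not_between_outer] excludes the first case. *)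
Lemma fstep_not_between S M T : fstep S T -> ~ between S M T.
Proof.
move=> fST; have ST := fstep_slide fST; have ns := double_s_lt_n.
case: fST => R [x [xR yR [vS vT SE TE]]] B; have n0 : 0 < n by arith.
have [SM MT _ _ _] := B; have [_ vM] := slide_vx SM.
have d1 := cdist_shift1 x; set y := shift 1 x in yR vT TE d1.
have xy : x != y by cyclic_at x.
have cxy : close x y by rewrite /close d1 hs.
rewrite SE TE in SM MT B.
have [v [vR ME vx' vy /andP[cvx cvy]]] :=
  slide_triangle xR yR xy cxy (slide_sym SM) MT.
rewrite ME in B vM; case: (ltnP (cdist v x) s) => vxs.
  apply: (not_between_outer vR xR yR vM vS vT _ _ B); move: cvy; rewrite /close;
  by cyclic_at x.
(* Now [v] is ahead; a reflection puts it behind, with [x] and [y] exchanged. *)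
have inj : injective (@mirror n 0) := can_inj (mirrorK n0).
apply: (@not_between_outer (mirror 0 @: R) (mirror 0 v) (mirror 0 y) (mirror 0 x));
  rewrite -?imsetU1 ?mem_imset ?cdist_mirror //.
- by case: (mirror_autom n0) => h _ _ _; case: (h _ vM).
- by case: (mirror_autom n0) => h _ _ _; case: (h _ vT).
- by case: (mirror_autom n0) => h _ _ _; case: (h _ vS).
- by move: cvx; rewrite /close; cyclic_at x.
- by move: cvx; rewrite /close; cyclic_at x.
exact: (autom_between (mirror_autom n0) (between_sym B)).
Qed.

(** A slide longer than one passes over the successor of its starting point, and that position is in
    between by [between_inner]. *)
Lemma stepP S T : step S T <-> slide S T /\ forall M, ~ between S M T.
Proof.
split=> [[fST|fST]|[ST noB]].
- split; first exact: fstep_slide.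
  by move=> M; apply: fstep_not_between.
- split; first exact/slide_sym/fstep_slide.
  by move=> M /between_sym; apply: fstep_not_between.
have half S' T' R x y : x \notin R -> y \notin R -> x != y -> cdist x y < s ->
    vx (x |: R) -> vx (y |: R) -> S' = x |: R -> T' = y |: R ->
    (forall M, ~ between S' M T') -> fstep S' T'.
  move=> xR yR xy xys vS vT SE TE nB; have ns := double_s_lt_n.
  have d1 := cdist_shift1 x; set m := shift 1 x in d1.
  have [my|my] := eqVneq m y.
    by exists R, x; rewrite -/m my; split.
  have far z w : vx (w |: R) -> w \notin R -> z \in R ->
      s <= cdist z w /\ s <= cdist w z.
    move=> vw wR zR; have zw : z != w by apply: contraNneq wR => <-.
    by split; apply: (vx_dist vw); rewrite ?setU11 ?setU1r // eq_sym.
  have mR : m \notin R.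
    by apply/negP => /(far _ _ vS xR); cyclic_at x.
  have vM : vx (m |: R).
    apply: (vx_setU1 xR mR vS) => z zR.
    by have := far z _ vS xR zR; have := far z _ vT yR zR; cyclic_at x.
  case: (nB (m |: R)); rewrite SE TE; apply: between_inner => //.
  by cyclic_at x.
case: ST => R x y xR yR xy cxy vS vT SE TE.
move: (cxy); rewrite /close => /orP[h|h].
  by left; apply: (half _ _ R x y).
right; apply: (half _ _ R y x) => //; first by rewrite eq_sym.
by move=> M /between_sym; apply: noB.
Qed.

Lemma step_vx S T : step S T -> vx S /\ vx T.
Proof. by case/stepP => /slide_vx. Qed.

Lemma autom_step F G S T : autom F G -> step S T -> step (F S) (F T).
Proof.
move=> a; have a' := autom_sym a; rewrite !stepP => -[ST nB].
split; first exact: (autom_slide a).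
have [vS vT] := slide_vx ST; have [_ FK _ _] := a.
by move=> M /(autom_between a'); rewrite !FK //; apply: nB.
Qed.

Lemma step_form S T : step S T -> exists Q z z', [/\ z \notin Q, z' \notin Q,
  S = z |: Q, T = z' |: Q & cdist z z' = 1 \/ cdist z' z = 1].
Proof.
case=> [] [Q [z [zQ z'Q [_ _ E1 E2]]]].
  by exists Q, z, (shift 1 z); split=> //; left; apply: cdist_shift1.
by exists Q, (shift 1 z), z; split=> //; right; apply: cdist_shift1.
Qed.

Lemma step_setU1 Q z z' : z \notin Q -> z' \notin Q -> vx (z |: Q) -> vx (z' |: Q) ->
  cdist z z' = 1 \/ cdist z' z = 1 -> step (z |: Q) (z' |: Q).
Proof.
move=> zQ z'Q v1 v2; have ns := double_s_lt_n; case=> h; [left|right].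
  have z'E : z' = shift 1 z by cyclic.
  by exists Q, z; rewrite -z'E; split.
have zE : z = shift 1 z' by cyclic.
by exists Q, z'; rewrite -zE; split.
Qed.

(** * Rigidity *)

Section Rigidity.
Variables (F G : {set 'I_n} -> {set 'I_n}) (aFG : autom F G).
Variables (R : {set 'I_n}) (x : 'I_n).
Let y := shift 1 x.
Let S := x |: R.
Let T := y |: R.
Hypotheses (xR : x \notin R) (yR : y \notin R) (vS : vx S) (vT : vx T).
Hypotheses (FS : F S = S) (FnS : forall X, step S X -> F X = X).

Let d1 : cdist x y = 1. Proof. exact: cdist_shift1. Qed.
Let xy : x != y.
Proof. by have := d1; have := double_s_lt_n; clear; cyclic_at x. Qed.
Let cxy : close x y. Proof. by rewrite /close d1 hs. Qed.
Let ST : step S T. Proof. by left; exists R, x; split. Qed.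
Let FT : F T = T. Proof. exact: FnS. Qed.
Let FstepT U : step T U -> step T (F U).
Proof. by move=> /(autom_step aFG); rewrite FT. Qed.
Let yS : y \notin S. Proof. by rewrite !inE negb_or eq_sym xy. Qed.
Let yT : y \in T. Proof. exact: setU11. Qed.
Let Finj U W : vx U -> vx W -> F U = F W -> U = W.
Proof. by case: aFG => _ FK _ _ vU vW /(congr1 G); rewrite !FK. Qed.
Let FneS U : vx U -> U <> S -> F U <> S.
Proof. by move=> vU US FU; apply: US; apply: Finj; rewrite ?FS. Qed.

(** The moved point is [y]; going back to [x] would give [S], so it goes on to the next position. *)
Lemma step_leaving U : step T U -> y \notin U -> U <> S ->
  exists w, [/\ w \notin R, cdist x w = 2 & U = w |: R].
Proof.
move=> TU yU US; have ns := double_s_lt_n; have dxy := d1.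
have [Q [z [w [zQ wQ TE UE zw]]]] := step_form TU.
have zy : y = z.
  have : y \in z |: Q by rewrite -TE.
  by rewrite !inE => /predU1P[//|yQ]; rewrite UE !inE yQ orbT in yU.
have QE : Q = R by rewrite -(setU1K zQ) -TE -zy /T setU1K.
exists w; rewrite -QE; split=> //.
have wx : w != x by apply/eqP => wx; apply: US; rewrite UE wx QE.
by move: zw; rewrite -zy; clear - ns dxy wx; cyclic_at x.
Qed.

(* Such a U is told apart from those containing y by the neighbourhoods of the
   graph: y lies in U exactly when every common neighbour of S and U is a
   neighbour of T. *)
Lemma fixed_leaving U : step T U -> y \notin U -> U <> S -> F U = U.
Proof.
move=> TU yU US; have ns := double_s_lt_n; have [_ vU] := step_vx TU.
have [w [wR dw UE]] := step_leaving TU yU US.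
case: (boolP (y \in F U)) => yFU; last first.
  have [w' [_ dw' ->]] := step_leaving (FstepT TU) yFU (FneS vU US).
  by rewrite UE; congr (_ |: _); clear -dw dw'; cyclic.
exfalso; have H : {in S &, forall a b, a != b -> 1 < cdist a b}.
  by move=> a b aS bS ab; apply: leq_trans hs (vx_dist vS aS bS ab).
(* A common neighbour of [S] and [U] that meets [T] in [y]. If [y] were in [F U], then [F C],
   avoiding [S] and [F U], would avoid [T]. *)
pose C := [set shift 1 e | e in S].
have vC : vx C.
  apply: (vx_shift vS) => [e _|a b aS bS ab]; first by arith.
  by have := vx_dist vS aS bS ab; arith.
have CS : [disjoint C & S] by apply: (shift_disjoint vS).
have yC : y \in C by apply/imsetP; exists x; rewrite // setU11.
have CU : [disjoint C & U].
  rewrite disjoints_subset; apply/subsetP => e eC; rewrite inE UE !inE negb_or.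
  apply/andP; split; last first.
    by move: (disjointFr CS eC); rewrite !inE => /norP[].
  apply/eqP => ew; have : y = e.
    apply: (vx_close vC yC eC); rewrite ew /close.
    by have := d1; clear - dw ns hs; cyclic_at x.
  by move=> ye; have := d1; rewrite ye ew dw.
case: (aFG) => FG _ _ FD; have [vFC _] := FG C vC; have [vFU _] := FG U vU.
have FCT : [disjoint F C & T].
  rewrite disjoints_subset; apply/subsetP => e eFC; rewrite inE.
  have FCS : [disjoint F C & S] by rewrite -FS FD.
  have FCU : [disjoint F C & F U] by rewrite FD.
  have := disjointFr FCS eFC; rewrite !inE negb_or => /norP[_ ->]; rewrite andbT.
  by apply/eqP => ey; move: (disjointFr FCU eFC); rewrite ey yFU.
move: FCT; rewrite -FT FD // => CT.
by move: (disjointFr CT yC); rewrite yT.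
Qed.

(** [S], [T], [U] and [z' |: S :\ z] form a square whose first, second and last vertices are fixed,
    so [F U] is again its corner opposite to [S]. *)
Lemma fixed_commuting U z z' Q : z \in R -> z' \notin S -> z' \notin Q -> z \notin Q ->
  T = z |: Q -> U = z' |: Q -> step T U -> cdist z z' = 1 \/ cdist z' z = 1 ->
  vx (z' |: S :\ z) -> F U = U.
Proof.
move=> zR z'S z'Q zQ TE UE TU zz' vX.
have [_ vU] := step_vx TU; have ns := double_s_lt_n.
have zx : x != z by apply: contraNneq xR => ->.
have zS : z \in S by rewrite setU1r.
have czz' : close z z' by rewrite /close; case: zz' => ->; rewrite hs ?orbT.
have SX : step S (z' |: S :\ z).
  rewrite -{1}(setD1K zS); apply: step_setU1; rewrite ?setD1K // !inE ?eqxx //.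
  by move: z'S; rewrite !inE negb_or => /andP[/negbTE-> /negbTE->]; rewrite andbF.
have yz : y != z by apply: contraNneq yR => ->.
have QE : Q = y |: R :\ z.
  apply/setP => a; have := congr1 (fun A : {set _} => a \in A) TE; rewrite !inE.
  have [->|_ /= <- //] := eqVneq a z; by rewrite (negbTE zQ) eq_sym (negbTE yz).
have XU : step (z' |: S :\ z) U.
  have XE : z' |: S :\ z = x |: (z' |: R :\ z).
    apply/setP => a; rewrite !inE; have [->|_] := eqVneq a x; rewrite ?orbT //.
    by rewrite zx orbT.
  have UE' : U = y |: (z' |: R :\ z) by rewrite UE QE setUCA.
  rewrite XE in vX *; rewrite UE' in vU *; apply: step_setU1 => //; last by left.
    rewrite !inE !negb_or (negbTE xR) andbF andbT.
    by apply: contraNneq z'S => <-; rewrite setU11.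
  rewrite !inE !negb_or (negbTE yR) andbF andbT.
  by apply: contraNneq z'Q => <-; rewrite QE setU11.
have sl V W : step V W -> slide W V by move=> /step_sym /stepP[].
have TS : T = y |: S :\ x by rewrite /S setU1K.
have corner W : step T W -> step (z' |: S :\ z) W -> W <> S ->
    W = z' |: (y |: S :\ x) :\ z.
  move=> TW XW; apply: (slide_square_corner vS (setU11 x R) zS) => //.
    by rewrite -TS; apply: sl.
  exact: sl.
have US : U <> S.
  by move=> E; move: yS; rewrite -E UE QE !inE eqxx orbT.
rewrite [RHS]corner //; apply: corner; [exact: FstepT| |exact: FneS].
by have := autom_step aFG XU; rewrite (FnS SX).
Qed.

(* If the path S, T, U completes to a square, its fourth vertex is fixed and
   determines U; otherwise U moves x - s to x - s + 1, a move that was blocked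
   by x in S. *)
Lemma step_blocked U : step T U -> y \in U -> F U = U \/
  exists z z', [/\ cdist x z = n - s, cdist x z' = n - s + 1 & U = z' |: T :\ z].
Proof.
move=> TU yU; have [_ vU] := step_vx TU; have ns := double_s_lt_n.
have [Q [z [z' [zQ z'Q TE UE zz']]]] := step_form TU.
have zz'n : z != z' by move: zz'; clear - ns; cyclic_at z.
have zU : z \notin U by rewrite UE !inE negb_or zz'n.
have zy : z != y by apply: contraNneq zU => ->.
have zR : z \in R.
  by have: z \in T; [rewrite TE setU11|rewrite !inE (negbTE zy)].
have QE : Q = T :\ z by rewrite TE setU1K.
have z'T : z' \notin T by rewrite TE !inE negb_or eq_sym zz'n.
have z'U : z' \in U by rewrite UE setU11.
have yz' : y != z' by apply: contraNneq z'T => <-.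
have z'y : z' != y by rewrite eq_sym.
have zx : z != x by apply: contraNneq xR => <-.
have d3 := vx_dist vU yU z'U yz'; have d4 := vx_dist vU z'U yU z'y.
have z'x : z' != x.
  apply/eqP => z'x; move: d4; rewrite z'x d1; arith.
have z'S : z' \notin S.
  by rewrite !inE negb_or z'x; move: z'T; rewrite !inE negb_or => /andP[].
have zS : z \in S by rewrite setU1r.
have d1' := vx_dist vS zS (setU11 x R) zx; have d2' := vx_dist vS (setU11 x R) zS.
rewrite eq_sym in d2'; have {}d2' := d2' zx.
have dxy := d1.
(* If [z'] is not close to [x], the move from [z] to [z'] is already possible in [S]. *)
case: (boolP (close z' x)) => cz'x; last first.
  left; apply: (fixed_commuting zR z'S z'Q zQ TE UE TU zz').
  have zD : z \notin S :\ z by rewrite !inE eqxx.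
  have z'D : z' \notin S :\ z by apply: contra z'S => /setD1P[].
  apply: (vx_setU1 zD z'D); rewrite ?setD1K // => e.
  rewrite !inE => /andP[ez /predU1P[->|eR]].
    by move: cz'x; rewrite /close negb_or -!leqNgt => /andP[].
  have eU : e \in U by rewrite UE QE !inE ez eR !orbT.
  have ez' : e != z' by apply: contraNneq z'S => <-; rewrite setU1r.
  by split; apply: (vx_dist vU) => //; rewrite eq_sym.
(* [z'] is close to [x], but [z] is not, nor is [z'] close to [y]: only the move from [x - s] to
   [x - s + 1] remains. *)
right; exists z, z'; rewrite UE QE; move: cz'x zz'; rewrite /close.
by move=> h1 h2; split=> //; clear - ns dxy d3 d4 d1' d2' h1 h2 hs; cyclic_at x.
Qed.

(** The previous lemmas leave at most one doubtful neighbour of [T]. By injectivity its image is not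
    one of the fixed neighbours, so it is fixed too. *)
Lemma fixed_neighbour U : step T U -> F U = U.
Proof.
move=> TU; have [_ vU] := step_vx TU; have [FG _ _ _] := aFG.
have [vFU _] := FG U vU.
have [->//|/eqP US] := eqVneq U S.
case: (boolP (y \in U)) => yU; last exact: fixed_leaving.
have TFU := FstepT TU; case: (boolP (y \in F U)) => yFU; last first.
  by apply: Finj => //; apply: fixed_leaving; rewrite //; apply: FneS.
case: (step_blocked TU yU) => // [[z [z' [dz dz' UE]]]].
case: (step_blocked TFU yFU) => [E|[w [w' [dw dw' FUE]]]]; first exact: Finj.
have zw : z = w by clear -dz dw; cyclic.
have zw' : z' = w' by clear -dz' dw'; cyclic.
by rewrite FUE -zw -zw' -UE.
Qed.
End Rigidity.

Definition frozen F S := F S = S /\ forall X, step S X -> F X = X.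

Lemma frozen_fstep F G S T : autom F G -> fstep S T -> frozen F S -> frozen F T.
Proof.
move=> a fST [FS FnS]; split; first by apply: FnS; left.
case: fST => R [x [xR yR [vS vT SE TE]]] U TU; rewrite SE in FS FnS; rewrite TE in TU.
exact: (fixed_neighbour a xR yR vS vT FS FnS).
Qed.

Lemma autom_conj F G H : autom H H -> autom F G ->
  autom (fun S => H (F (H S))) (fun S => H (G (H S))).
Proof.
move=> [HG HK _ HD] [FG FK GK FD].
have vH S : vx S -> vx (H S) by move=> /HG[].
have vF S : vx S -> vx (F S) by move=> /FG[].
have vG S : vx S -> vx (G S) by move=> /FG[].
split=> [S vS|S vS|S vS|S T vS vT].
- by split; auto.
- by rewrite HK ?FK ?HK //; auto.
- by rewrite HK ?GK ?HK //; auto.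
by rewrite HD ?FD ?HD //; auto.
Qed.

(** Conjugation by a reflection turns a backward step into a forward one. *)
Lemma frozen_step F G S T : autom F G -> step S T -> frozen F S -> frozen F T.
Proof.
move=> a [fST|fTS]; first exact: (frozen_fstep a).
have n0 : 0 < n by have := double_s_lt_n; arith.
have am := mirror_autom n0; set H := fun _ => _ in am.
have [HG HK _ _] := am; have a' := autom_conj am a.
have [vT vS] : vx T /\ vx S by apply: step_vx; left.
have [_ FK GK _] := (a); have [FG _ _ _] := a.
have fr X : vx X -> frozen F X <-> frozen (fun S => H (F (H S))) (H X).
  move=> vX; split=> -[FX FnX]; split.
  - by rewrite HK ?FX.
  - move=> U /[dup] /step_vx[_ vU] /(autom_step am); rewrite HK // => /FnX ->.
    by rewrite HK.
  - have [vFX _] := FG X vX; rewrite HK // in FX.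
    by rewrite -(HK (F X)) // FX HK.
  move=> U XU; have [_ vU] := step_vx XU; have [vFU _] := FG U vU.
  have := FnX _ (autom_step am XU); rewrite HK // => E.
  by rewrite -(HK (F U)) // E HK.
have fm : fstep (H S) (H T).
  case: fTS => R [x [xR yR [v1 v2 TE SE]]].
  exists (mirror 0 @: R), (mirror 0 (shift 1 x)).
  have E : shift 1 (mirror 0 (shift 1 x)) = mirror 0 x.
    by apply/esym/cdist_eq_shift; rewrite cdist_mirror // cdist_shift1.
  have inj : injective (@mirror n 0) := can_inj (mirrorK n0).
  rewrite E !mem_imset // -!imsetU1 -SE -TE; split=> //; split=> //.
    by have [] := HG S vS.
  by have [] := HG T vT.
by rewrite !fr //; apply: (frozen_fstep a').
Qed.

(** * Packed sets and connectedness *)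

Definition packed c : {set 'I_n} := [set shift (j * s) c | j : 'I_k].

(** For [j = k - 1] this says that the gap closing the circle in a packed set exceeds [s]; this is
    where [n] must be larger than [s * k]. *)
Lemma mul_s_lt j : j < k -> j * s + s < n.
Proof. by move=> jk; have : j.+1 * s <= k * s; [rewrite leq_mul2r jk orbT|nia]. Qed.

Lemma cdist_shift t c : t < n -> cdist c (shift t c) = t.
Proof. by move=> tn; cyclic. Qed.

Lemma packedP c z : reflect (exists2 j, j < k & cdist c z = j * s) (z \in packed c).
Proof.
apply: (iffP imsetP) => [[j _ ->]|[j jk dz]].
  exists j => //; rewrite cdist_shift //.
  by have := mul_s_lt (ltn_ord j); arith.
by exists (Ordinal jk) => //=; apply: cdist_eq_shift.
Qed.

Lemma packed_base c : c \in packed c.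
Proof. by apply/packedP; exists 0; rewrite ?cdist_self //; arith. Qed.

Lemma packed_vx c : vx (packed c).
Proof.
apply/vxP; split.
  rewrite card_imset ?card_ord // => i j E; apply/val_inj.
  have := mul_s_lt (ltn_ord i); have := mul_s_lt (ltn_ord j) => hi hj.
  have : i * s = j * s.
    by rewrite -(@cdist_shift (i * s) c) ?E ?cdist_shift //; arith.
  by move/eqP; rewrite eqn_mul2r; case/orP => /eqP //; have := hs; arith.
move=> x y /packedP[i ik dx] /packedP[j jk dy] xy.
have hi := mul_s_lt ik; have hj := mul_s_lt jk.
have ij : i * s + s <= j * s \/ j * s + s <= i * s.
  have : i != j by apply: contraNneq xy => ij; apply/eqP; clear -dx dy ij; cyclic.
  rewrite neq_ltn => /orP[h|h]; [left|right]; rewrite -mulSnr leq_mul2r h orbT //.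
by clear - dx dy ij hi hj; cyclic_at c.
Qed.

Lemma shift0 c : shift 0 c = c.
Proof. by apply/esym/cdist_eq_shift; exact: cdist_self. Qed.

(* Otherwise every point other than [c] has a predecessor at distance exactly
   [s], which forces [S = packed c]. *)
Lemma gap_exists S c : vx S -> c \in S -> S != packed c ->
  exists z, [/\ z \in S, z != c & forall y, y \in S -> y != z -> s < cdist y z].
Proof.
move=> vS cS SP.
case: (boolP [exists z in S, (z != c) &&
    [forall y in S, (y != z) ==> (s < cdist y z)]]) => [|/exists_inPn none].
  case/exists_inP => z zS /andP[zc /forall_inP H]; exists z; split=> // y yS yz.
  by have := H y yS; rewrite yz.
have back z : z \in S -> z != c -> exists2 y, y \in S & cdist c y + s = cdist c z.
  move=> zS zc; have := none z zS; rewrite zc /= => /forall_inPn[y yS].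
  rewrite negb_imply -leqNgt => /andP[yz le]; exists y => //.
  have := vx_dist vS yS zS yz; have cz : c != z by rewrite eq_sym.
  by have := vx_dist vS cS zS cz; clear - le; cyclic_at c.
(* Going back from [z] in strides of [s] until [c] puts every smaller multiple of [s] in [S]. *)
have chain m z : cdist c z <= m -> z \in S ->
    exists2 j, cdist c z = j * s & forall i, i <= j -> shift (i * s) c \in S.
  elim: m z => [|m IH] z le zS; have [zc|zc] := eqVneq z c.
  - exists 0; first by rewrite zc cdist_self.
    by case=> // _; rewrite mul0n shift0.
  - by exfalso; clear - le zc; cyclic_at c.
  - exists 0; first by rewrite zc cdist_self.
    by case=> // _; rewrite mul0n shift0.
  have [y yS yz] := back z zS zc.
  have [|j dj ij] := IH y _ yS; first by have := hs; arith.
  exists j.+1 => [|i]; first by rewrite -yz dj mulSnr.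
  rewrite leq_eqVlt => /predU1P[->|]; last exact: ij.
  by rewrite mulSnr -dj yz -(cdist_eq_shift (erefl (cdist c z))).
(* A point outside [packed c] is at a multiple [j * s] with [j >= k], so its chain contains all of
   [packed c]. *)
have [z /andP[zS zk]|none'] := pickP [pred z in S | z \notin packed c]; last first.
  case/eqP: SP; apply: vx_sub (packed_vx c) _ => //; apply/subsetP => z zS.
  by have := none' z; rewrite /= zS /= => /negbFE.
case/eqP: SP; apply/esym/vx_sub => //; first exact: packed_vx.
apply/subsetP => w /imsetP[i _ ->].
have [j dj ij] := chain _ z (leqnn _) zS; apply: ij.
have : ~~ (j < k) by apply: contra zk => jk; apply/packedP; exists j.
by have := ltn_ord i; arith.
Qed.

Lemma forward_move S e : vx S -> e \in S ->
  (forall y, y \in S -> y != e -> s < cdist e y) -> fstep S (shift 1 e |: S :\ e).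
Proof.
move=> vS eS H; have d1 := cdist_shift1 e; have ns := double_s_lt_n.
have eD : e \notin S :\ e by rewrite !inE eqxx.
have fD : shift 1 e \notin S :\ e.
  apply/negP => /setD1P[fe fS]; have := H _ fS fe; rewrite d1; arith.
exists (S :\ e), e; rewrite setD1K //; split=> //; split=> //.
apply: (vx_setU1 eD fD); rewrite ?setD1K // => z /setD1P[ze zS].
have := H z zS ze; have := vx_dist vS zS eS ze.
by clear - d1 ns ze; cyclic_at e.
Qed.

Lemma backward_move S e : vx S -> e \in S ->
  (forall y, y \in S -> y != e -> s < cdist y e) ->
  exists2 f, cdist f e = 1 & fstep (f |: S :\ e) S.
Proof.
move=> vS eS H; have ns := double_s_lt_n.
have d1 : cdist (shift n.-1 e) e = 1 by clear - ns hs; cyclic.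
set f := shift n.-1 e in d1; exists f => //.
have eD : e \notin S :\ e by rewrite !inE eqxx.
have fD : f \notin S :\ e.
  apply/negP => /setD1P[fe fS]; have := H _ fS fe; rewrite d1; arith.
exists (S :\ e), f; rewrite -(cdist_eq_shift d1) setD1K //; split=> //; split=> //.
apply: (vx_setU1 eD fD); rewrite ?setD1K // => z /setD1P[ze zS].
have ez : e != z by rewrite eq_sym.
have := H z zS ze; have := vx_dist vS eS zS ez.
by clear - d1 ns ze; cyclic_at e.
Qed.

(** * Connectedness, as an induction principle for properties preserved by steps *)

Section Connectivity.
Variables (K : {set 'I_n} -> Prop) (Kstep : forall S T, step S T -> K S -> K T).

(** Induction on the sum of the distances from [c]: unless [S] is packed, [gap_exists] gives a point
    other than [c] that can move back by one. *)
Lemma connected_to_packed S c : vx S -> c \in S -> (K S <-> K (packed c)).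
Proof.
have [m le] := ubnP (\sum_(z in S) cdist c z); elim: m S le => // m IH S le vS cS.
have [->//|SP] := eqVneq S (packed c).
have [z [zS zc zgap]] := gap_exists vS cS SP.
have [f df fS] := backward_move vS zS zgap; set T := f |: S :\ z in fS.
have TS : step T S by left.
have [vT _] := step_vx TS.
have fD : f \notin S :\ z.
  apply/negP => /setD1P[fz fS']; have := zgap f fS' fz; rewrite df; have := hs; arith.
have cT : c \in T by rewrite !inE cS (eq_sym c z) zc orbT.
rewrite -(IH T) //; first by split; apply: Kstep => //; exact: step_sym.
rewrite (leq_trans _ (_ : \sum_(i in S) cdist c i <= m)) //.
rewrite big_setU1 // [X in _ < X](big_setD1 z zS) /= ltn_add2r.
by clear - df zc; cyclic_at c.
Qed.

Lemma packed_gap c y : y \in packed c -> y != shift (k.-1 * s) c ->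
  s < cdist (shift (k.-1 * s) c) y.
Proof.
move=> yP; have k1 : k.-1 < k by have := hk; arith.
have := mul_s_lt k1; have dl : k.-1 * s < n by have := mul_s_lt k1; arith.
have := cdist_shift c dl; set l := shift _ c => dl' h yl.
have lP : l \in packed c by apply/packedP; exists k.-1.
have le : cdist c y <= k.-1 * s.
  by case/packedP: yP => j jk ->; rewrite leq_mul2r; apply/orP; right; arith.
by clear - dl' h yl le; cyclic_at c.
Qed.

(** Take the packed set whose last point is [c]. Moving that point forward yields a vertex
    containing [shift 1 c]; both vertices are linked to the packed sets at these points. *)
Lemma connected_packed_shift1 c : K (packed c) -> K (packed (shift 1 c)).
Proof.
have k1 : k.-1 < k by have := hk; arith.
have h := mul_s_lt k1.
have t0 : 0 < k.-1 * s by rewrite muln_gt0; have := hk; have := hs; arith.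
set t := k.-1 * s in h t0.
have [b db] : exists b, cdist b c = t.
  by exists (shift (n - t) c); clear - h hs t0; cyclic.
have bE := cdist_eq_shift db.
have cP : c \in packed b by apply/packedP; exists k.-1.
have fS := forward_move (packed_vx b) cP.
have {}fS : fstep (packed b) (shift 1 c |: packed b :\ c).
  by apply: fS => y yP yc; rewrite bE; apply: packed_gap; rewrite // -bE.
have sS : step (packed b) (shift 1 c |: packed b :\ c) by left.
have [_ vT] := step_vx sS.
rewrite -(connected_to_packed (packed_vx b) cP).
rewrite -(connected_to_packed vT (setU11 _ _)).
exact: Kstep.
Qed.

Lemma connected c S : K (packed c) -> vx S -> K S.
Proof.
move=> Kc vS; have [e eS _] := vx_other c vS.
rewrite (connected_to_packed vS eS) (cdist_eq_shift (erefl (cdist c e))).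
elim: (cdist c e) => [|t IH]; first by rewrite shift0.
have -> : shift t.+1 c = shift 1 (shift t c).
  by apply: val_inj; rewrite /= modnDml -addnA addn1.
exact: connected_packed_shift1.
Qed.
End Connectivity.

(** * Counting step neighbours of packed and unpacked vertices *)

Definition packed_next c := let l := shift (k.-1 * s) c in
  shift 1 l |: packed c :\ l.

Lemma packed_next_step c : step (packed c) (packed_next c).
Proof.
have k1 : k.-1 < k by have := hk; arith.
have h := mul_s_lt k1; left; apply: forward_move; first exact: packed_vx.
  by apply/packedP; exists k.-1; rewrite ?cdist_shift //; arith.
by move=> y yP yl; apply: packed_gap.
Qed.

(* A packed set has a single gap larger than [s], hence only two moves. *)
Lemma packed_neighbours c : exists B, forall U, step (packed c) U ->
  U = packed_next c \/ U = B.
Proof.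
have ns := double_s_lt_n; have k1 : k.-1 < k by have := hk; arith.
have h := mul_s_lt k1.
have d1 : cdist (shift n.-1 c) c = 1 by clear - ns hs; cyclic.
set f := shift n.-1 c in d1; exists (f |: packed c :\ c) => U.
case=> [] [R [x [xR yR [vS vT SE TE]]]].
  left; rewrite TE /packed_next; set l := shift _ c.
  have xP : x \in packed c by rewrite SE setU11.
  suff xl : x = l by rewrite -xl SE setU1K.
  (* Any point but the last is blocked by the next one, exactly [s] ahead. *)
  apply/eqP; apply/negPn/negP => xl; case/packedP: (xP) => j jk dx.
  have jk' : j.+1 < k.
    rewrite ltn_neqAle jk andbT; apply: contraNneq xl => jk1; apply/eqP.
    by rewrite (cdist_eq_shift dx) /l -jk1.
  have hj := mul_s_lt jk'.
  have dz : cdist c (shift (j.+1 * s) c) = j.+1 * s by apply: cdist_shift; arith.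
  set z := shift (j.+1 * s) c in dz.
  have zP : z \in packed c by apply/packedP; exists j.+1.
  rewrite mulSnr in dz hj.
  have zx : z != x by clear - dx dz hs; cyclic_at c.
  have zR : z \in R by move: zP; rewrite SE !inE (negbTE zx).
  have zT : z \in shift 1 x |: R by rewrite setU1r.
  have yz : shift 1 x != z by apply: contraNneq yR => ->.
  have := vx_dist vT (setU11 _ _) zT yz; have := cdist_shift1 x.
  by clear - dx dz hs hj; set y := shift 1 x; clearbody y; cyclic_at c.
right; have dyx := cdist_shift1 x; set y := shift 1 x in yR vT TE dyx.
have yP : y \in packed c by rewrite TE setU11.
suff yc : y = c.
  rewrite SE; have -> : x = f by rewrite yc in dyx; clear - dyx d1; cyclic.
  by rewrite TE yc setU1K // -yc.
(* Backwards, any point but [c] is blocked by the previous one. *)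
apply/eqP; apply/negPn/negP => yc; case/packedP: (yP) => j jk dy.
case: j jk dy => [|j] jk dy; first by move: yc; clear - dy; cyclic_at c.
have hj := mul_s_lt jk; rewrite mulSnr in dy hj.
have dz : cdist c (shift (j * s) c) = j * s by apply: cdist_shift; arith.
set z := shift (j * s) c in dz.
have zP : z \in packed c by apply/packedP; exists j => //; arith.
have zy : z != y by clear - dy dz hs; cyclic_at c.
have zR : z \in R by move: zP; rewrite TE !inE (negbTE zy).
have zS : z \in x |: R by rewrite setU1r.
have zx : z != x by apply: contraNneq xR => <-.
have := vx_dist vS zS (setU11 _ _) zx.
by clear - dy dz hs hj dyx; cyclic_at c.
Qed.

(** Two applications of [gap_exists] give two points, [c] and [z], that can move back; the point [e]
    just before [c] can move forward. *)
Lemma unpacked_neighbours S : vx S -> (forall c, S != packed c) ->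
  exists U1 U2 U3, [/\ step S U1, step S U2, step S U3 &
    [/\ U1 != U2, U1 != U3 & U2 != U3]].
Proof.
move=> vS nP; have ns := double_s_lt_n; have n0 : 0 < n by arith.
have [c0 c0S _] := vx_other (Ordinal n0) vS.
have [c [cS _ cgap]] := gap_exists vS c0S (nP c0).
have [z [zS zc zgap]] := gap_exists vS cS (nP c).
have [e0 e0S e0c] := vx_other c vS.
have Pe0 : (e0 \in S) && (e0 != c) by rewrite e0S.
case: (@arg_minnP _ e0 (fun e => (e \in S) && (e != c)) (fun e => cdist e c) Pe0).
move=> e /andP[eS ec] emin.
have egap y : y \in S -> y != e -> s < cdist e y.
  move=> yS ye; have ce := cgap e eS ec; have [->//|yc] := eqVneq y c.
  have := emin y; rewrite yS yc => /(_ isT) le; have ey : e != y by rewrite eq_sym.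
  by clear - ce yc le ey ye; cyclic_at c.
have [f1 d1 s1] := backward_move vS cS cgap.
have [f2 d2 s2] := backward_move vS zS zgap.
have s3 := forward_move vS eS egap; have d3 := cdist_shift1 e.
set f3 := shift 1 e in s3 d3.
have new x f : x \in S -> cdist f x = 1 \/ cdist x f = 1 -> f \notin S.
  move=> xS d; apply/negP => fS; have fx : f != x by clear - d ns; case: d; cyclic_at x.
  have xf : x != f by rewrite eq_sym.
  by have := vx_dist vS fS xS fx; have := vx_dist vS xS fS xf; have := hs; arith.
have n1 := new c f1 cS (or_introl d1); have n2 := new z f2 zS (or_introl d2).
have n3 := new e f3 eS (or_intror d3).
have diff f g a b : f \notin S -> b \in S -> a != b \/ f != g -> a \in S ->
    f |: S :\ a != g |: S :\ b.
  move=> fS bS ab aS; apply/eqP => E.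
  have fg : f = g.
    have : f \in g |: S :\ b by rewrite -E setU11.
    by rewrite !inE (negbTE fS) andbF orbF => /eqP.
  case: ab => [ab|]; last by rewrite fg eqxx.
  have : b \in f |: S :\ a by rewrite !inE (eq_sym b a) ab bS orbT.
  rewrite E !inE eqxx /= orbF => /eqP bg; by rewrite fg -bg bS in fS.
exists (f1 |: S :\ c), (f2 |: S :\ z), (f3 |: S :\ e).
split; [by right|by right|by left|].
split; apply: diff => //.
- by left; rewrite eq_sym.
- by left; rewrite eq_sym.
have [ze|ze] := eqVneq z e; [right|by left].
by clear - ze d2 d3 ns hs; rewrite -ze in d3; cyclic_at z.
Qed.

(** Three step neighbours of the image would pull back to three of [packed c], which has at most
    two. *)
Lemma autom_packed F G c : autom F G -> exists c', F (packed c) = packed c'.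
Proof.
move=> a; have a' := autom_sym a; have [FG FK GK _] := a.
have vP := packed_vx c; have [vFP _] := FG _ vP.
have [/existsP[c' /eqP->]|/existsPn nP] :=
  boolP [exists c', F (packed c) == packed c']; first by exists c'.
have [U1 [U2 [U3 [s1 s2 s3 [n12 n13 n23]]]]] := unpacked_neighbours vFP nP.
have [B HB] := packed_neighbours c.
have pull U : step (F (packed c)) U -> G U = packed_next c \/ G U = B.
  by move=> /(autom_step a'); rewrite FK //; apply: HB.
have inj U W : step (F (packed c)) U -> step (F (packed c)) W -> U != W -> G U != G W.
  move=> /step_vx[_ vU] /step_vx[_ vW]; apply: contraNneq => /(congr1 F).
  by rewrite !GK // => ->.
have := inj _ _ s1 s2 n12; have := inj _ _ s1 s3 n13; have := inj _ _ s2 s3 n23.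
by case: (pull _ s1) => ->; case: (pull _ s2) => ->; case: (pull _ s3) => ->;
  rewrite eqxx.
Qed.

(** With one of its at most two step neighbours fixed, [packed c] is frozen, and [connected] spreads
    this to all vertices. *)
Lemma autom_eq_id F G c : autom F G -> F (packed c) = packed c ->
  F (packed_next c) = packed_next c -> forall S, vx S -> F S = S.
Proof.
move=> a FP FN S vS; have [FG FK _ _] := a.
suff [] : frozen F S by [].
apply: (@connected (frozen F) _ c) vS => [? ?|]; first exact: (frozen_step a).
split=> // X PX; have [B HB] := packed_neighbours c.
have [_ vN] := step_vx (packed_next_step c); have [_ vX] := step_vx PX.
case: (HB X PX) => [->//|XB]; have := autom_step a PX; rewrite FP => /HB[E|->//].
by rewrite -(FK X vX) E -FN FK.
Qed.

Lemma autom_swap F G c : autom F G -> F (packed c) = packed c ->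
  forall B, step (packed c) B -> B <> packed_next c ->
  F (packed_next c) = packed_next c \/ F (packed_next c) = B.
Proof.
move=> a FP B PB nB; have := autom_step a (packed_next_step c); rewrite FP.
have [B' HB] := packed_neighbours c; move=> /HB[|->]; first by left.
by right; case: (HB B PB).
Qed.

(** * The automorphism group *)

Lemma shift_shift t u x : shift t (shift u x) = shift (u + t) x.
Proof. by apply: val_inj; rewrite /= modnDml addnA. Qed.

Lemma shift_full x : shift n x = x.
Proof. by apply: val_inj; rewrite /= modnDr modn_small. Qed.

Lemma cdist_shift2 t x y : t < n -> cdist (shift t x) (shift t y) = cdist x y.
Proof. by move=> tn; cyclic. Qed.

Lemma shift1_autom :
  autom (fun S => @shift n 1 @: S) (fun S => @shift n n.-1 @: S).
Proof.
have ns := double_s_lt_n; apply: imset_autom => [x|x|x y].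
- by rewrite shift_shift (_ : 1 + n.-1 = n) ?shift_full //; arith.
- by rewrite shift_shift (_ : n.-1 + 1 = n) ?shift_full //; arith.
by rewrite /close !cdist_shift2 //; arith.
Qed.

Lemma shift_packed t c : shift t @: packed c = packed (shift t c).
Proof.
rewrite /packed -imset_comp; apply: eq_imset => j /=.
by rewrite !shift_shift addnC.
Qed.

(** In [packed c] every point but [c] has a predecessor at distance [s], whereas the gap behind [c']
    in [packed c'] is larger. *)
Lemma packed_inj : injective packed.
Proof.
move=> c c' E; apply/eqP; apply/negPn/negP => cc'.
have: c' \in packed c by rewrite E packed_base.
case/packedP => -[|j] jk dc'; first by move: cc'; clear - dc'; cyclic_at c.
have hj := mul_s_lt jk; rewrite mulSnr in dc' hj.
have dz : cdist c (shift (j * s) c) = j * s by apply: cdist_shift; arith.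
set z := shift (j * s) c in dz.
have : z \in packed c by apply/packedP; exists j => //; arith.
rewrite E => /packedP[i ik dz']; have := mul_s_lt ik.
by clear - dz dz' dc' hj hs; cyclic_at c.
Qed.

Lemma shift_mirror_shift a x : a < n ->
  shift 1 (mirror a (shift 1 x)) = mirror a x.
Proof.
by move=> an; apply/esym/cdist_eq_shift; rewrite cdist_mirror // cdist_shift1.
Qed.

Lemma n_gt0 : 0 < n. Proof. by have := double_s_lt_n; arith. Qed.

Let c0 : 'I_n := Ordinal n_gt0.
(** The last point of the packed set at 0, so that [mirror a0] reverses this set. *)
Let a0 := k.-1 * s.

Lemma a0_lt : a0 + s < n.
Proof. by apply: mul_s_lt; have := hk; arith. Qed.

Lemma a0_ltn : a0 < n.
Proof. by have := a0_lt; arith. Qed.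

Lemma a0_gt0 : 0 < a0.
Proof. by rewrite muln_gt0; have := hk; have := hs; arith. Qed.

Lemma mirror_packed : mirror a0 @: packed c0 = packed c0.
Proof.
have an := a0_ltn; apply: vx_sub (packed_vx _) _.
  by have [h _ _ _] := mirror_autom an; case: (h _ (packed_vx c0)).
apply/subsetP => _ /imsetP[z /packedP[j jk dz] ->].
apply/packedP; exists (k.-1 - j); first by have := hk; arith.
rewrite mulnBl -/a0 -dz; have : j * s <= a0.
  by rewrite leq_mul2r; apply/orP; right; arith.
have c00 : nat_of_ord c0 = 0 by [].
by rewrite -dz; clear - an c00; clearbody c0 a0; cyclic.
Qed.

Let l0 := shift a0 c0.

Lemma cdist_l0 : cdist c0 l0 = a0.
Proof. exact/cdist_shift/a0_ltn. Qed.

Lemma l0_notin_next : l0 \notin packed_next c0.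
Proof.
have := cdist_shift1 l0; rewrite /packed_next -/a0 -/l0 !inE eqxx /= orbF => d.
by move: d; clear; set y := shift 1 l0; clearbody y l0; cyclic_at l0.
Qed.

(** [l0] has left the set, but it is the mirror image of [c0], which has stayed. *)
Lemma mirror_next_neq : mirror a0 @: packed_next c0 <> packed_next c0.
Proof.
move=> E; have := l0_notin_next; rewrite -E => /negP; apply.
have -> : l0 = mirror a0 c0.
  have := cdist_l0; have : nat_of_ord c0 = 0 by []; have := a0_ltn.
  by clear; clearbody l0 c0 a0; cyclic.
rewrite imset_f // /packed_next -/a0 -/l0 !inE packed_base andbT.
apply/orP; right; have := cdist_l0; have := a0_gt0.
by clear; clearbody l0 c0 a0; cyclic_at c0.
Qed.

(** * From maps on sets to permutations of the vertex type, and the group itself *)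

Local Notation V := (stable_kneser_vertex n k s).
Local Notation Aut := (graph_Aut (@stable_kneser n k s)).

(** The value [S] on non-vertices is arbitrary, since [autom] constrains vertices only. *)
Definition on_sets (f : {perm V}) S : {set 'I_n} :=
  if insub S is Some v then val (f v) else S.

Lemma on_setsE f (v : V) : on_sets f (val v) = val (f v).
Proof. by rewrite /on_sets valK. Qed.

Lemma vertex_of S : vx S -> exists v : V, val v = S.
Proof. by move=> vS; exists (Sub S vS); rewrite SubK. Qed.

Lemma on_sets_autom f : f \in Aut -> autom (on_sets f) (on_sets f^-1%g).
Proof.
move=> /graph_AutP Hf.
split=> [S /vertex_of[v <-]|S /vertex_of[v <-]|S /vertex_of[v <-]|].
- by rewrite !on_setsE; split; apply: valP.
- by rewrite !on_setsE permK.
- by rewrite !on_setsE permKV.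
by move=> S T /vertex_of[u <-] /vertex_of[v <-]; rewrite !on_setsE; exact: Hf.
Qed.

Lemma autom_perm F G : autom F G ->
  exists2 f : {perm V}, f \in Aut & forall v, val (f v) = F (val v).
Proof.
move=> [FG FK _ FD].
have vF (v : V) : F (val v) \in stable_ksets n k s by case: (FG _ (valP v)).
have inj : injective (fun v : V => Sub (F (val v)) (vF v) : V).
  move=> u v /(congr1 val); rewrite !SubK => /(congr1 G).
  by rewrite !FK; [exact: val_inj|exact: (valP v)|exact: (valP u)].
exists (perm inj) => [|v]; last by rewrite permE SubK.
apply/graph_AutP => u v; rewrite !permE /stable_kneser !SubK.
by apply: FD; [exact: (valP u)|exact: (valP v)].
Qed.

(** Two distinct involutions generate a dihedral group, so it suffices to find two that generate
    [Aut] and to count its elements. *)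
Lemma Aut_dihedral : (Aut \isog 'D_(2 * n))%g.
Proof.
have [rho rhoA rhoE] := autom_perm shift1_autom.
have [sig sigA sigE] := autom_perm (mirror_autom a0_ltn).
have [v0 v0E] := vertex_of (packed_vx c0).
have [vN vNE] : exists v : V, val v = packed_next c0.
  by apply: vertex_of; have [] := step_vx (packed_next_step c0).
have rhoXE i v : val ((rho ^+ i)%g v) = shift i @: val v.
  elim: i => [|i IH]; first by rewrite expg0 perm1 (eq_imset _ shift0) imset_id.
  rewrite expgSr permM rhoE IH -imset_comp; apply: eq_imset => x /=.
  by rewrite shift_shift addn1.
have sigK : (sig * sig = 1)%g.
  apply/permP => v; apply: val_inj; rewrite permM perm1 !sigE -imset_comp.
  by rewrite (eq_imset _ (mirrorK a0_ltn)) imset_id.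
have sig0 : sig v0 = v0 by apply: val_inj; rewrite sigE v0E mirror_packed.
have sigN : sig vN <> vN.
  by move=> /(congr1 val); rewrite sigE vNE; apply: mirror_next_neq.
have sig1 : sig != 1%g by apply/eqP => E; apply: sigN; rewrite E perm1.
have rho0 i : (rho ^+ i)%g v0 = v0 -> shift i c0 = c0.
  by move/(congr1 val); rewrite rhoXE v0E shift_packed; apply: packed_inj.
have rhon : (rho ^+ n = 1)%g.
  apply/permP => v; apply: val_inj; rewrite rhoXE perm1.
  by rewrite (eq_imset _ shift_full) imset_id.
have ordrho : #[rho]%g = n.
  apply/eqP; rewrite eqn_dvd order_dvdn rhon eqxx /=.
  have := rho0 #[rho]%g; rewrite expg_order perm1 => /(_ erefl) /(congr1 val).
  by rewrite /= add0n => /eqP.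
have rigid g : g \in Aut -> g v0 = v0 -> g vN = vN -> g = 1%g.
  move=> gA g0 gN; apply/permP => v; apply: val_inj; rewrite perm1 -on_setsE.
  apply: (autom_eq_id (on_sets_autom gA) (c := c0)) (valP v).
    by rewrite -v0E on_setsE g0.
  by rewrite -vNE on_setsE gN.
(* An element of the stabiliser of [v0] fixes [vN] or sends it to [sig vN]; [rigid] applies to [g]
   or to [g * sig]. *)
have split_g g : g \in Aut -> g v0 = v0 -> g = 1%g \/ g = sig.
  move=> gA g0; have gP : on_sets g (packed c0) = packed c0 by rewrite -v0E on_setsE g0.
  have PB : step (packed c0) (val (sig vN)).
    have := autom_step (mirror_autom a0_ltn) (packed_next_step c0).
    by rewrite mirror_packed sigE vNE.
  have nB : val (sig vN) <> packed_next c0 by rewrite -vNE => /val_inj.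
  have := autom_swap (on_sets_autom gA) gP PB nB; rewrite -vNE on_setsE.
  case=> /val_inj gN; [left; exact: rigid|right].
  have gs : (g * sig = 1)%g.
    apply: rigid; first by rewrite groupM.
      by rewrite permM g0.
    by rewrite permM gN -permM sigK perm1.
  by rewrite -[g]mulg1 -sigK mulgA gs mul1g.
(* [f] sends [v0] to a packed set; rotating back lands in the stabiliser of [v0]. *)
have decomp f : f \in Aut ->
    exists i, f = (rho ^+ i)%g \/ f = (sig * rho ^+ i)%g.
  move=> fA; have [c' fP] := autom_packed c0 (on_sets_autom fA).
  exists (cdist c0 c'); set i := cdist c0 c'.
  have f0 : f v0 = (rho ^+ i)%g v0.
    apply: val_inj; rewrite rhoXE -on_setsE v0E fP shift_packed; congr packed.
    exact: cdist_eq_shift.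
  have [||E|E] := split_g (f * (rho ^+ i)^-1)%g.
  - by rewrite groupM ?groupV ?groupX.
  - by rewrite permM f0 permK.
  - by left; rewrite -[RHS]mul1g -E mulgKV.
  by right; rewrite -E mulgKV.
(* A power of [rho] fixing [v0] is trivial, while [sig] fixes [v0] and is not. *)
have sig_rho : sig \notin <[rho]>%g.
  apply/cycleP => -[i E]; have := rho0 i; rewrite -E sig0 => /(_ erefl).
  move=> /(congr1 val) /= /eqP; rewrite add0n => ni; case/negP: sig1.
  by rewrite E -order_dvdn ordrho.
have cardA : #|Aut| = 2 * n.
  have -> : Aut = (<[rho]> :|: sig *: <[rho]>)%g.
    apply/eqP; rewrite eqEsubset; apply/andP; split; apply/subsetP => f.
      case/decomp=> i [->|->]; rewrite inE; apply/orP; [left|right].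
        exact: mem_cycle.
      by rewrite mem_lcoset mulKg mem_cycle.
    rewrite inE => /orP[/cycleP[i ->]|/lcosetP[_ /cycleP[i ->] ->]].
      exact: groupX.
    by rewrite groupM // groupX.
  rewrite cardsU (_ : (_ :&: _)%g = set0) ?cards0 ?subn0; last first.
    apply/setP => f; rewrite !inE; apply/andP => -[f1]; rewrite mem_lcoset => f2.
    by case/negP: sig_rho; rewrite -groupV -(groupMr _ f1).
  by rewrite card_lcoset -orderE ordrho mul2n addnn.
(* The second involution, again a reflection; [sig * tau] recovers [rho]. *)
pose tau := (sig * rho)%g.
have rho1 : rho != 1%g.
  by rewrite -order_eq1 ordrho; have := double_s_lt_n; have := hs; arith.
have tauK : (tau * tau = 1)%g.
  apply/permP => v; apply: val_inj; rewrite !permM perm1 !rhoE !sigE !rhoE !sigE.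
  rewrite -!imset_comp -[RHS]imset_id; apply: eq_imset => x /=.
  by rewrite shift_mirror_shift ?a0_ltn // mirrorK // a0_ltn.
have tau1 : tau != 1%g.
  apply: contra sig_rho => /eqP E; have -> : sig = (rho^-1)%g.
    by rewrite -[sig](mulgK rho) -/tau E mul1g.
  by rewrite groupV cycle_id.
have genA : Aut = <<[set sig; tau]>>%g.
  apply/eqP; rewrite eqEsubset gen_subG; apply/andP; split; last first.
    by apply/subsetP => f /set2P[->|->]; rewrite ?groupM.
  have sg : sig \in <<[set sig; tau]>>%g by rewrite mem_gen // set21.
  have tg : tau \in <<[set sig; tau]>>%g by rewrite mem_gen // set22.
  have rg : rho \in <<[set sig; tau]>>%g.
    by have := groupM (groupVr sg) tg; rewrite mulKg.
  apply/subsetP => f /decomp[i [->|->]]; first exact: groupX.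
  by apply: groupM => //; apply: groupX.
have := @involutions_gen_dihedral _ sig tau; rewrite /= -genA cardA; apply.
- by apply: nt_prime_order => //; rewrite expgS expg1.
- by apply: nt_prime_order => //; rewrite expgS expg1.
by apply: contraNneq rho1 => E; rewrite -(mulKg sig rho) -/tau -E mulVg.
Qed.

End StableSets.

Theorem theorem5 (n s k : nat) (hk : 2 <= k) (hs : 2 <= s)
    (hn : s * k + 1 <= n) :
  (graph_Aut (@stable_kneser n k s) \isog 'D_(2 * n))%g.
Proof. exact: Aut_dihedral. Qed.
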